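(* Let $\mathcal{H}\neq\{0\}$ be a real Hilbert space, let $T>0$, let $r>0$ and let $\mathcal{Z}\subseteq\mathcal{H}$ be an $r$-prox-regular set. The play operator $$\mathsf{P}: \big(C([0,T];\mathcal{H})\cap BV([0,T];\mathcal{H})\big)\times\mathcal{Z}\to C([0,T];\mathcal{H})\cap BV([0,T];\mathcal{H})$$ is continuous with respect to the strict metric $d_s$; i.e., if $u,u_n\in C([0,T];\mathcal{H})\cap BV([0,T];\mathcal{H})$ and $z_0,z_{0,n}\in\mathcal{Z}$ for every $n\in\mathbb{N}$, and $$d_s(u,u_n)\to 0,\qquad \|z_0-z_{0,n}\|\to 0\qquad\text{as } n\to\infty,$$ then $$d_s\big(\mathsf{P}(u,z_0),\mathsf{P}(u_n,z_{0,n})\big)\to 0\qquad\text{as } n\to\infty.$$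
   Context: Inner product and norm of $\mathcal{H}$ are $\langle\cdot,\cdot\rangle$ and $\|\cdot\|$. Prox-regularity: for closed nonempty $\mathcal{K}\subseteq\mathcal{H}$ and $y\in\mathcal{H}$ put $d_{\mathcal{K}}(y)=\inf_{s\in\mathcal{K}}\|y-s\|$ and $\mathrm{Proj}_{\mathcal{K}}(y)=\{x\in\mathcal{K}: \|x-y\|=d_{\mathcal{K}}(y)\}$. For $r\in(0,\infty)$, a closed set $\mathcal{K}$ is $r$-prox-regular if for every $y\in\mathcal{H}$ with $0<d_{\mathcal{K}}(y)<r$ one has $\mathrm{Proj}_{\mathcal{K}}(y)\neq\varnothing$ and $x\in\mathrm{Proj}_{\mathcal{K}}\big(x+r\frac{y-x}{\|y-x\|}\big)$ for all $x\in\mathrm{Proj}_{\mathcal{K}}(y)$. Functions of bounded variation: $V(f,J)=\sup\sum_{j=1}^m\|f(t_j)-f(t_{j-1})\|$, the supremum being over all $m\ge1$ and $t_0<\dots<t_m$ in $J$. $BV([0,T];\mathcal{H})$ is the set of $f:[0,T]\to\mathcal{H}$ with $V(f,[0,T])<\infty$. The strict metric is $$d_s(f,g)=\|f-g\|_\infty+\big|V(f,[0,T])-V(g,[0,T])\big|,\qquad \|f\|_\infty=\sup_{t\in[0,T]}\|f(t)\|.$$ For continuous $f\in BV([0,T];\mathcal{H})$, $Df$ is its differential (Lebesgue–Stieltjes) measure: the unique $\mathcal{H}$-valued Borel measure of bounded variation on $[0,T]$ with $Df([c,d])=f(d)-f(c)$ for $0\le c\le d\le T$; $|Df|$ denotes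 its total variation measure. For bounded Borel $g:[0,T]\to\mathcal{H}$ that are $|Df|$-integrable, $\int_{[0,T]}\langle g,dDf\rangle$ is the continuous linear extension (in the $L^1(|Df|;\mathcal{H})$ seminorm) of $\sum_j\langle g_j,Df(A_j)\rangle$ for step maps $\sum_j \mathbf{1}_{A_j}g_j$. Play operator: for $u\in C([0,T];\mathcal{H})\cap BV([0,T];\mathcal{H})$ and $z_0\in\mathcal{Z}$, $\mathsf{P}(u,z_0)$ is the unique (it is known that it exists and is unique) $y\in C([0,T];\mathcal{H})\cap BV([0,T];\mathcal{H})$ such that $u(t)-y(t)\in\mathcal{Z}$ for all $t\in[0,T]$, $u(0)-y(0)=z_0$, and $$\int_{[0,T]}\langle z(t)-u(t)+y(t),dDy(t)\rangle\le\frac1{2r}\int_{[0,T]}\|z(t)-u(t)+y(t)\|^2\,d|Dy|(t)$$ for all $z\in BV([0,T];\mathcal{H})$ with $z([0,T])\subseteq\mathcal{Z}$. *)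

(* Defs.v *)
From HB Require Import structures.
From mathcomp Require Import all_boot all_order all_algebra sesquilinear.
From mathcomp Require Import all_classical all_reals all_analysis.

Set Implicit Arguments.
Unset Strict Implicit.
Unset Printing Implicit Defensive.

Import Order.TTheory GRing.Theory Num.Theory.
Import numFieldNormedType.Exports.

Local Open Scope classical_set_scope.
Local Open Scope ring_scope.

(* A real Hilbert space is a complete normed module [H] together with an inner
   product [dot : {dot H for idfun}] (a symmetric positive definite bilinear
   form) such that [`|x| ^+ 2 = dot x x].
   Functions on [0, T] are represented by functions on the whole line; every
   notion below only depends on their restriction to [`[0, T]]. *)

Section prox_regularity.
Context {R : realType} {H : normedModType R}.
Implicit Types (K : set H) (x y : H) (r : R).

Definition dist_to K y : R := inf [set `|y - s| | s in K].

Definition proj K y : set H := [set x | K x /\ `|x - y| = dist_to K y].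

Definition prox_regular r K :=
  [/\ closed K, K !=set0 &
    forall y, 0 < dist_to K y < r ->
      proj K y !=set0 /\
      forall x, proj K y x -> proj K (x + (r / `|y - x|) *: (y - x)) x].

End prox_regularity.

Section bounded_variation.
Context {R : realType} {H : normedModType R}.
Implicit Types (f g : R -> H) (J : set R) (T : R).

Definition variation_on f J : \bar R :=
  ereal_sup [set v | exists m (t : nat -> R),
    [/\ (0 < m)%N,
        forall i, (i < m)%N -> t i < t i.+1,
        forall i, (i <= m)%N -> J (t i) &
        v = (\sum_(i < m) `|f (t i.+1) - f (t i)|)%:E]].

Definition BV_on T f := (variation_on f `[0%R, T] < +oo)%E.

Definition CBV_on T f := {within `[0, T], continuous f} /\ BV_on T f.

(* Both [sup] and [fine] are meaningful for functions of bounded variation,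
   since these are bounded on [`[0, T]] and have finite variation. *)
Definition sup_norm T f : R := sup [set `|f t| | t in `[0, T]].

Definition strict_dist T f g : R :=
  sup_norm T (f \- g) +
  `|fine (variation_on f `[0, T]) - fine (variation_on g `[0, T])|.

End bounded_variation.

Section vector_measure.
Context {R : realType} {H : normedModType R}.
Implicit Types (mu : set (measurableTypeR R) -> H) (f g : R -> H) (T : R).

Definition vector_measure mu :=
  forall F : nat -> set (measurableTypeR R),
    (forall n, measurable (F n)) -> trivIset setT F ->
    (fun n => \sum_(i < n) mu (F i)) @ \oo --> mu (\bigcup_n F n).

(* For [A] measurable; the supremum is over countable measurable partitions. *)
Definition tv_measure mu (A : set (measurableTypeR R)) : \bar R :=
  ereal_sup [set v | exists F : nat -> set (measurableTypeR R),
    [/\ forall n, measurable (F n), trivIset setT F, \bigcup_n F n = A &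
        v = (\sum_(0 <= n <oo) (`|mu (F n)|)%:E)%E]].

(* [mu] is Df: a Borel measure on [`[0, T]] is represented by a Borel measure
   on the line which vanishes outside [`[0, T]]. *)
Definition is_differential_measure T f mu :=
  [/\ vector_measure mu,
      forall A, measurable A -> mu A = mu (A `&` `[0, T]),
      (tv_measure mu setT < +oo)%E &
      forall c d, 0 <= c -> c <= d -> d <= T -> mu `[c, d]%classic = f d - f c].

(* The list of the pairs (A_j, g_j) encodes the step map sum_j 1_(A_j) g_j. *)
Definition step_data := seq (set (measurableTypeR R) * H).

Definition step_map (s : step_data) (t : R) : H :=
  \sum_(p <- s) (\1_(p.1) t : R) *: p.2.

Definition step_integral (dot : {dot H for idfun}) mu (s : step_data) : R :=
  \sum_(p <- s) dot p.2 (mu p.1).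

Definition bounded_borel T g :=
  (exists M : R, forall t, t \in `[0, T] -> `|g t| <= M) /\
  (forall U : set H, open U ->
    measurable (`[0, T] `&` g @^-1` U : set (measurableTypeR R))).

(* [I] is the integral of <g, d mu> over [`[0, T]], the value at [g] of the
   extension by L^1(|mu|)-continuity of [step_integral]. *)
Definition is_integral_dot (dot : {dot H for idfun}) T mu g (I : R) :=
  bounded_borel T g /\
  exists s : nat -> step_data,
    [/\ forall n, {in s n, forall p, measurable p.1},
        (\int[tv_measure mu]_(t in `[0%R, T]) (`|g t - step_map (s n) t|)%:E)%E
          @[n --> \oo] --> (0 : \bar R) &
        step_integral dot mu (s n) @[n --> \oo] --> I].

End vector_measure.

(* [y = P(u, z0)]. The differential measure of [y] and the integrals of the
   [H]-valued functions involved exist and are unique; [mu] and [I] name them. *)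
Definition is_play {R : realType} {H : normedModType R}
    (dot : {dot H for idfun}) (T r : R) (Z : set H)
    (u : R -> H) (z0 : H) (y : R -> H) :=
  [/\ CBV_on T y,
      forall t, t \in `[0, T] -> Z (u t - y t),
      u 0 - y 0 = z0 &
      exists2 mu : set (measurableTypeR R) -> H,
        is_differential_measure T y mu &
        forall z : R -> H, BV_on T z -> (forall t, t \in `[0, T] -> Z (z t)) ->
          exists2 I : R,
            is_integral_dot dot T mu (fun t => z t - u t + y t) I &
            (I%:E <= ((2 * r)^-1)%:E *
               \int[tv_measure mu]_(t in `[0%R, T])
                 (`|z t - u t + y t| ^+ 2)%:E)%E].

(* Main.v *)
Require Import Defs.
From HB Require Import structures.
From mathcomp Require Import all_boot all_order all_algebra sesquilinear.
From mathcomp Require Import all_classical all_reals all_analysis.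
From mathcomp Require Import measurable_realfun.
From mathcomp Require Import zify ring lra.
Import Order.TTheory GRing.Theory Num.Theory.
Import numFieldNormedType.Exports.

Set Implicit Arguments.
Unset Strict Implicit.
Unset Printing Implicit Defensive.

Local Open Scope classical_set_scope.
Local Open Scope ring_scope.

(** Write x = u - y for the state of the play. Up to a quadratic term, the
    variational inequality says that dy points into the normal cone of Z at x.
    Testing it with functions that are constant on a short interval, and equal
    to x elsewhere, gives the local inequality [play_ineq], in which only
    increments of y and its variation occur ([play_ineq_of_is_play]). This rests
    on the fact that the total variation measure of dy is the Stieltjes measure
    of the variation function of y ([tv_measure_stieltjes]).

    Since x moves in Z, both x(t+h) and x(t-h) are admissible test points, so
    that <dx, dy> can have neither sign: dx and dy are orthogonal. Therefore
    |dx + dy| = |dx - dy|, that is, the input u = x + y and its reflection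
    u - 2 y = x - y have the same variation on every interval
    ([tvar_reflect_le]). Derivatives are avoided by an energy argument: on a
    subdivision for which the sum of |f t' - f t|^2 / (A t' - A t) is nearly
    maximal, f is nearly affine with respect to the clock A on most intervals
    ([chain_sum_defect_le]). In particular y varies at most as much as u.

    Testing the inequality of each of two outputs with the state of the other
    one yields a Gronwall estimate for their distance ([play_gronwall]), whose
    constant depends only on the variations, and these are bounded by those of
    the inputs. Thus y_n tends to y uniformly.

    It remains to see that the variations converge. By hypothesis the length of
    u_n tends to that of u, hence by reflection the length of u_n - 2 y_n tends
    to that of u - 2 y. On a subdivision that is nearly optimal for both limits,
    u_n and u_n - 2 y_n nearly run on straight segments, at the same speed. So
    does y_n, being half of their difference; its length is then close to the
    sum of its increments, hence to that of the increments of y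
    ([tvar_continuous]). *)

(** * Sums of interval functions over subdivisions *)

Section interval_functions.
Context {R : realType}.
Implicit Types (F G A : R -> R -> R) (p q s : R) (l : seq R).

Definition chain p q l : Prop := path <=%R p l /\ last p l = q.

Fixpoint chain_sum F p l : R := if l is q :: l' then F p q + chain_sum F q l' else 0.

Definition additive_itv A :=
  forall p q s, p <= q -> q <= s -> A p s = A p q + A q s.

Definition subadditive_itv F :=
  forall p q s, p <= q -> q <= s -> F p s <= F p q + F q s.

Definition bounded_sums F :=
  forall p q, exists c, forall l, chain p q l -> chain_sum F p l <= c.

(** Refining a subdivision increases the sums of such a function, and these stay
    bounded. Increments of functions of bounded variation and the energies used
    below are of this kind. *)
Definition rectifiable F :=
  [/\ forall p q, p <= q -> 0 <= F p q, forall p, F p p = 0,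
      subadditive_itv F & bounded_sums F].

Definition total_sum F p q : R := sup [set chain_sum F p l | l in chain p q].

Lemma chain_nil p : chain p p [::]. Proof. by []. Qed.

Lemma chain_seq1 p q : p <= q -> chain p q [:: q].
Proof. by move=> pq; split=> //=; rewrite pq. Qed.

Lemma chain_cons p q s l : chain p q (s :: l) <-> p <= s /\ chain s q l.
Proof.
split=> [[/= /andP[ps sl] e]|[ps [sl e]]]; first by [].
by split=> //=; rewrite ps.
Qed.

Lemma chain_le p q l : chain p q l -> p <= q.
Proof.
elim: l p => [|s l IH] p; first by case=> _ /= ->.
by move=> /chain_cons[ps /IH]; exact: le_trans.
Qed.

Lemma chain_cat p q s l1 l2 :
  chain p q l1 -> chain q s l2 -> chain p s (l1 ++ l2).
Proof.
move=> [h1 e1] [h2 e2]; split; first by rewrite cat_path h1 e1.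
by rewrite last_cat e1.
Qed.

Lemma chain_sum_cat F p l1 l2 :
  chain_sum F p (l1 ++ l2) = chain_sum F p l1 + chain_sum F (last p l1) l2.
Proof. by elim: l1 p => [|s l IH] p /=; rewrite ?add0r// IH addrA. Qed.

Lemma ler_chain_sum_path (e : rel R) F G p q l : chain p q l -> path e p l ->
  (forall a b, p <= a -> a <= b -> b <= q -> e a b -> F a b <= G a b) ->
  chain_sum F p l <= chain_sum G p l.
Proof.
elim: l p => [|s l IH] p //= /chain_cons[ps cl] /andP[eps el] FG.
rewrite lerD//; first by rewrite FG// (chain_le cl).
by apply: IH => // a b sa ab bq eab; rewrite FG// (le_trans ps).
Qed.

Lemma ler_chain_sum F G p q l : chain p q l ->
  (forall a b, p <= a -> a <= b -> b <= q -> F a b <= G a b) ->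
  chain_sum F p l <= chain_sum G p l.
Proof.
move=> /[dup] cl [pl _] FG; apply: (ler_chain_sum_path cl pl) => a b pa ab bq _.
exact: FG.
Qed.

Lemma chain_sumD F G p l :
  chain_sum (fun a b => F a b + G a b) p l = chain_sum F p l + chain_sum G p l.
Proof. by elim: l p => [|s l IH] p /=; rewrite ?addr0// IH addrACA. Qed.

Lemma chain_sumZ k F p l : chain_sum (fun a b => k * F a b) p l = k * chain_sum F p l.
Proof. by elim: l p => [|s l IH] p /=; rewrite ?mulr0// IH mulrDr. Qed.

Lemma additive_itv0 A p : additive_itv A -> A p p = 0.
Proof. by move=> addA; have := addA p p p (lexx p) (lexx p); lra. Qed.

Lemma chain_sum_additive A p q l : additive_itv A -> chain p q l ->
  chain_sum A p l = A p q.
Proof.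
move=> addA; elim: l p => [|s l IH] p.
  by move=> [_ /= <-]; rewrite additive_itv0.
by move=> /chain_cons[ps cl] /=; rewrite IH// -addA// (chain_le cl).
Qed.

Lemma le_chain_sum_subadditive F p q l : (forall p, F p p = 0) ->
  subadditive_itv F -> chain p q l -> F p q <= chain_sum F p l.
Proof.
move=> F0 subF; elim: l p => [|s l IH] p; first by move=> [_ /= <-]; rewrite F0.
move=> /chain_cons[ps cl] /=; rewrite (le_trans (subF p s q ps _)) ?(chain_le cl)//.
by rewrite lerD2l IH.
Qed.

Lemma bounded_sums_additive F A : additive_itv A ->
  (forall p q, p <= q -> F p q <= A p q) -> bounded_sums F.
Proof.
move=> addA FA p q; exists (A p q) => l cl; rewrite -(chain_sum_additive addA cl).
by apply: (ler_chain_sum cl) => a b _ ab _; exact: FA.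
Qed.

Lemma exists_fine_chain d p q : 0 < d -> p <= q ->
  exists2 l, chain p q l & path (fun a b => b < a + d) p l.
Proof.
move=> d_gt0 pq.
have [n hn] : exists n : nat, q - p <= n%:R * (d / 2).
  exists (Num.bound ((q - p) / (d / 2))).
  rewrite -ler_pdivrMr ?divr_gt0// ltW// archi_boundP//.
  by rewrite divr_ge0 ?subr_ge0// ltW// divr_gt0.
elim: n p pq hn => [|n IH] p pq hn.
  by rewrite mul0r in hn; have -> : q = p by [lra]; exists [::].
have [pd|pd] := leP q (p + d / 2).
  exists [:: q]; first exact: chain_seq1.
  by rewrite /= andbT; lra.
have [||l cl fl] := IH (p + d / 2); [lra| rewrite -natr1 in hn; lra |].
exists (p + d / 2 :: l); first by apply/chain_cons; split=> //; lra.
by rewrite /= fl andbT; lra.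
Qed.

(** The relation is composed along a subdivision into short intervals. *)
Lemma local_to_global (P : R -> R -> Prop) d : 0 < d -> (forall p, P p p) ->
  (forall p q s, p <= q -> q <= s -> P p q -> P q s -> P p s) ->
  (forall p q, p <= q -> q < p + d -> P p q) -> forall p q, p <= q -> P p q.
Proof.
move=> d_gt0 P0 Ptr Ploc p q pq.
have [l] := exists_fine_chain d_gt0 pq.
elim: l p {pq} => [|s l IH] p; first by move=> [_ /= <-].
move=> /chain_cons[ps cl] /= /andP[sd fl].
by apply: (Ptr p s) => //; [exact: chain_le cl|exact: Ploc|exact: IH].
Qed.

Section rectifiable.
Variable F : R -> R -> R.
Hypothesis rF : rectifiable F.

Lemma has_sup_chain_sum p q : p <= q -> has_sup [set chain_sum F p l | l in chain p q].
Proof.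
move=> pq; case: rF => _ _ _ /(_ p q)[c Fc]; split.
  by exists (chain_sum F p [:: q]), [:: q] => //; exact: chain_seq1.
by exists c => _ [l cl <-]; exact: Fc.
Qed.

Lemma chain_sum_le_total_sum p q l : chain p q l -> chain_sum F p l <= total_sum F p q.
Proof.
move=> cl; apply: sup_upper_bound; last by exists l.
exact/has_sup_chain_sum/chain_le/cl.
Qed.

Lemma total_sum_le p q c : p <= q ->
  (forall l, chain p q l -> chain_sum F p l <= c) -> total_sum F p q <= c.
Proof.
move=> pq Fc; apply: ge_sup; last by move=> _ [l cl <-]; exact: Fc.
by case: (has_sup_chain_sum pq).
Qed.

Lemma le_total_sum p q : p <= q -> F p q <= total_sum F p q.
Proof. by move=> /chain_seq1/chain_sum_le_total_sum; rewrite /= addr0. Qed.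

Lemma total_sum_ge0 p q : p <= q -> 0 <= total_sum F p q.
Proof.
by move=> pq; rewrite (le_trans _ (le_total_sum pq))//; case: rF => /(_ p q pq).
Qed.

Lemma total_sum_approx p q e : 0 < e -> p <= q ->
  exists2 l, chain p q l & total_sum F p q - e < chain_sum F p l.
Proof.
by move=> e0 pq; have [_ [l cl <-] h] := sup_adherent e0 (has_sup_chain_sum pq); exists l.
Qed.

(** Concatenating subdivisions gives superadditivity, inserting the middle point
    into a subdivision gives subadditivity. *)
Lemma total_sum_additive : additive_itv (total_sum F).
Proof.
case: (rF) => F_ge0 F0 subF _.
have super p q s : p <= q -> q <= s ->
    total_sum F p q + total_sum F q s <= total_sum F p s.
  move=> pq qs; rewrite -lerBrDr; apply: total_sum_le => // l1 cl1.
  rewrite lerBrDr -lerBrDl; apply: total_sum_le => // l2 cl2.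
  rewrite lerBrDl; have := chain_sum_le_total_sum (chain_cat cl1 cl2).
  by rewrite chain_sum_cat (proj2 cl1).
move=> p q s pq qs; apply/eqP; rewrite eq_le super// andbT.
apply: total_sum_le => [|l]; first exact: le_trans qs.
elim: l p pq => [|a l IH] p pq.
  by move=> _ /=; rewrite addr_ge0 ?total_sum_ge0.
move=> /chain_cons[pa cl] /=; have [aq|qa] := leP a q.
  have := IH _ aq cl; have := super p a q pa aq; have := le_total_sum pa; lra.
have : chain_sum F q (a :: l) <= total_sum F q s.
  by apply: chain_sum_le_total_sum; apply/chain_cons; split=> //; exact: ltW.
have := subF p q a pq (ltW qa); have := le_total_sum pq => /=; lra.
Qed.

Lemma total_sum_least A p q : p <= q -> additive_itv A ->
  (forall a b, p <= a -> a <= b -> b <= q -> F a b <= A a b) ->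
  total_sum F p q <= A p q.
Proof.
move=> pq addA FA; apply: total_sum_le => // l cl.
by rewrite -(chain_sum_additive addA cl); apply: (ler_chain_sum cl FA).
Qed.

End rectifiable.

Lemma additive_itvD A B : additive_itv A -> additive_itv B ->
  additive_itv (fun p q => A p q + B p q).
Proof. by move=> hA hB p q s pq qs; rewrite (hA p q s)// (hB p q s)// addrACA. Qed.

Lemma additive_itvZ k A : additive_itv A -> additive_itv (fun p q => k * A p q).
Proof. by move=> hA p q s pq qs; rewrite (hA p q s)// mulrDr. Qed.

Lemma rectifiableD F G : rectifiable F -> rectifiable G ->
  rectifiable (fun p q => F p q + G p q).
Proof.
move=> [F1 F2 F3 hF] [G1 G2 G3 hG]; split.
- by move=> p q pq; rewrite addr_ge0 ?F1 ?G1.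
- by move=> p; rewrite F2 G2 addr0.
- by move=> p q s pq qs; have := F3 _ _ _ pq qs; have := G3 _ _ _ pq qs; lra.
- move=> p q; have [c hc] := hF p q; have [d hd] := hG p q.
  by exists (c + d) => l cl; rewrite chain_sumD lerD ?hc ?hd.
Qed.

(** Both sums are nearly attained by one and the same subdivision, because
    refining a subdivision increases either of them. *)
Lemma total_sumD_ge F G p q : rectifiable F -> rectifiable G -> p <= q ->
  total_sum F p q + total_sum G p q <= total_sum (fun a b => F a b + G a b) p q.
Proof.
move=> rF rG pq; have rFG := rectifiableD rF rG.
rewrite -lerBrDr; apply: total_sum_le => // l cl; rewrite lerBrDr.
rewrite -(chain_sum_additive (total_sum_additive rG) cl) -chain_sumD.
rewrite -(chain_sum_additive (total_sum_additive rFG) cl).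
apply: ler_chain_sum cl _ => a b _ ab _.
rewrite -lerBrDl; apply: total_sum_le => // l' cl'; rewrite lerBrDl.
apply: le_trans (chain_sum_le_total_sum rFG cl'); rewrite chain_sumD lerD2r.
by case: rF => _ F0 subF _; exact: le_chain_sum_subadditive.
Qed.

End interval_functions.

(** * Variation of vector-valued functions *)

Section variation.
Context {R : realType} {H : normedModType R}.
Implicit Types (f g : R -> H) (p q : R).

Definition incr f p q : R := `|f q - f p|.
Definition tvar f := total_sum (incr f).
Definition locBV f := bounded_sums (incr f).

Lemma incr0 f p : incr f p p = 0. Proof. by rewrite /incr subrr normr0. Qed.

Lemma incr_subadditive f : subadditive_itv (incr f).
Proof.
move=> p q s _ _; rewrite /incr [leRHS]addrC; apply: le_trans (ler_normD _ _).
by rewrite addrA subrK.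
Qed.

Lemma rect_incr f : locBV f -> rectifiable (incr f).
Proof.
by move=> bf; split=> // [p q _|p|]; [exact: normr_ge0|exact: incr0|exact: incr_subadditive].
Qed.

Lemma tvar_additive f : locBV f -> additive_itv (tvar f).
Proof. by move/rect_incr/total_sum_additive. Qed.

Lemma le_tvar f p q : locBV f -> p <= q -> `|f q - f p| <= tvar f p q.
Proof. by move/rect_incr/le_total_sum => /[apply]. Qed.

Lemma tvar_ge0 f p q : locBV f -> p <= q -> 0 <= tvar f p q.
Proof. by move/rect_incr/total_sum_ge0 => /[apply]. Qed.

Lemma locBV_lin f g (k : R) : locBV f -> locBV g -> locBV (fun t => f t + k *: g t).
Proof.
move=> bf bg p q; have [c hc] := bf p q; have [d hd] := bg p q.
exists (c + `|k| * d) => l cl.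
apply: (@le_trans _ _ (chain_sum (fun a b => incr f a b + `|k| * incr g a b) p l)).
  apply: (ler_chain_sum cl) => a b _ _ _.
  by rewrite /incr opprD addrACA -scalerBr (le_trans (ler_normD _ _))// normrZ.
by rewrite chain_sumD chain_sumZ lerD ?hc// ler_wpM2l// hd.
Qed.

End variation.

(** * Inner product identities *)

Section inner_product.
Context {R : realType} {H : normedModType R}.
Variable dot : {dot H for idfun}.
Hypothesis dotE : forall x : H, `|x| ^+ 2 = dot x x.
Implicit Types a b c : H.

Lemma dotC a b : dot a b = dot b a.
Proof. by rewrite hermC expr0 mul1r. Qed.

Lemma dotDl a b c : dot (a + b) c = dot a c + dot b c.
Proof. exact: linearDl. Qed.
Lemma dotDr a b c : dot a (b + c) = dot a b + dot a c.
Proof. exact: linearDr. Qed.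
Lemma dotNl a b : dot (- a) b = - dot a b.
Proof. exact: linearNl. Qed.
Lemma dotNr a b : dot a (- b) = - dot a b.
Proof. exact: linearNr. Qed.
Lemma dotBl a b c : dot (a - b) c = dot a c - dot b c.
Proof. by rewrite dotDl dotNl. Qed.
Lemma dotBr a b c : dot a (b - c) = dot a b - dot a c.
Proof. by rewrite dotDr dotNr. Qed.
Lemma dotZl k a b : dot (k *: a) b = k * dot a b.
Proof. exact: linearZl_LR. Qed.
Lemma dotZr k a b : dot a (k *: b) = k * dot a b.
Proof. by rewrite dotC dotZl dotC. Qed.
Lemma dot0l a : dot 0 a = 0.
Proof. exact: linear0l. Qed.
Lemma dot0r a : dot a 0 = 0.
Proof. exact: linear0r. Qed.

Lemma sqr_normD a b : `|a + b| ^+ 2 = `|a| ^+ 2 + 2 * dot a b + `|b| ^+ 2.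
Proof. by rewrite !dotE dotDl !dotDr [dot b a]dotC; ring. Qed.

Lemma sqr_normB a b : `|a - b| ^+ 2 = `|a| ^+ 2 - 2 * dot a b + `|b| ^+ 2.
Proof. by rewrite sqr_normD dotNr normrN; ring. Qed.

Lemma dot_le a b : dot a b <= `|a| * `|b|.
Proof.
have : `|a + b| ^+ 2 <= (`|a| + `|b|) ^+ 2 by rewrite lerXn2r ?nnegrE ?addr_ge0// ler_normD.
by rewrite sqr_normD; lra.
Qed.

Lemma dot_ge a b : - (`|a| * `|b|) <= dot a b.
Proof. by have := dot_le (- a) b; rewrite dotNl normrN; lra. Qed.

Lemma norm_le_dot a : exists2 e, `|e| <= 1 & dot e a = `|a|.
Proof.
have [->|a0] := eqVneq a 0; first by exists 0; rewrite ?normr0// dot0l.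
exists (`|a|^-1 *: a); first by rewrite normrZ normfV normr_id mulVf ?normr_eq0.
by rewrite dotZl -dotE expr2 mulKf ?normr_eq0.
Qed.

End inner_product.

(** * Energy of a subdivision and approximately affine functions *)

Section flatness.
Context {R : realType} {H : normedModType R}.
Variable dot : {dot H for idfun}.
Hypothesis dotE : forall x : H, `|x| ^+ 2 = dot x x.
Implicit Types (d a : H) (f x y : R -> H) (A : R -> R -> R) (s t p q k h : R).

(** Young's inequality n <= k h + n^2 / (4 k h) for n = |d - h a|, with n^2 / h
    expanded. If h = 0, the convention x / 0 = 0 makes both sides vanish. *)
Lemma norm_subZ_le k h d a : 0 < k -> `|d| <= h ->
  `|d - h *: a| <=
  k * h + (4 * k)^-1 * (`|d| ^+ 2 / h - 2 * dot d a + h * `|a| ^+ 2).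
Proof.
move=> k0 dh; have [h0|h0] := eqVneq h 0.
  have /eqP : `|d| = 0 by apply/eqP; rewrite eq_le normr_ge0 -h0 dh.
  rewrite normr_eq0 => /eqP ->.
  by rewrite h0 scale0r subrr dot0l !normr0 expr0n/= !(mul0r,mulr0,subr0,addr0).
have hp : 0 < h by rewrite lt_def h0 (le_trans _ dh).
set n := `|_ - _|.
have n2 : n ^+ 2 = `|d| ^+ 2 - 2 * h * dot d a + h ^+ 2 * `|a| ^+ 2.
  by rewrite /n (sqr_normB dotE) dotZr normrZ exprMn real_normK ?num_real//; ring.
have -> : `|d| ^+ 2 / h - 2 * dot d a + h * `|a| ^+ 2 = n ^+ 2 / h.
  by rewrite n2; field.
have -> : k * h + (4 * k)^-1 * (n ^+ 2 / h) = n + (n - 2 * k * h) ^+ 2 / (4 * k * h).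
  by field; rewrite h0 gt_eqF.
by rewrite lerDl divr_ge0 ?sqr_ge0// !mulr_ge0// ltW.
Qed.

(** Velocity and energy of f with respect to the clock A. Quotients by 0 are 0, which
    suits functions that move only when the clock does. *)
Definition slope A f s t : H := (A s t)^-1 *: (f t - f s).
Definition energy A f p q : R := `|f q - f p| ^+ 2 / A p q.
Definition defect A f a p q : R := `|f q - f p - A p q *: a|.

Lemma slopeK A f s t : `|f t - f s| <= A s t -> A s t *: slope A f s t = f t - f s.
Proof.
rewrite /slope; have [->|A0] := eqVneq (A s t) 0.
  by rewrite scale0r normr_le0 => /eqP ->.
by rewrite scalerA divff// scale1r.
Qed.

Lemma norm_slope_le1 A f s t : `|f t - f s| <= A s t -> `|slope A f s t| <= 1.
Proof.
rewrite /slope normrZ normfV => fA.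
have A0 : 0 <= A s t by rewrite (le_trans _ fA).
rewrite ger0_norm//; have [->|An0] := eqVneq (A s t) 0.
  by rewrite invr0 mul0r.
by rewrite mulrC ler_pdivrMr ?mul1r// lt_def An0.
Qed.

(** Expanding the squares, the cross terms telescope: what is left is the
    increase of the energy under the subdivision. *)
Lemma chain_sum_defect_le A f k s t l : additive_itv A ->
  (forall p q, p <= q -> `|f q - f p| <= A p q) -> 0 < k -> chain s t l ->
  chain_sum (defect A f (slope A f s t)) s l <=
  k * A s t + (4 * k)^-1 * (chain_sum (energy A f) s l - energy A f s t).
Proof.
move=> addA fA k0 cl; set a := slope _ _ _ _.
have st := chain_le cl.
pose B p q := k * A p q + (4 * k)^-1 * (- 2 * dot (f q - f p) a + `|a| ^+ 2 * A p q).
have addB : additive_itv B.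
  move=> p q u pq qu; rewrite /B (addA p q u)//.
  have -> : f u - f p = (f q - f p) + (f u - f q) by rewrite [RHS]addrC addrA subrK.
  by rewrite dotDl; ring.
apply: (@le_trans _ _ (chain_sum (fun p q => (4 * k)^-1 * energy A f p q + B p q) s l)).
  apply: (ler_chain_sum cl) => p q _ pq _.
  apply: le_trans (norm_subZ_le a k0 (fA _ _ pq)) _.
  by rewrite /energy /B; lra.
have eD : f t - f s = A s t *: a by rewrite slopeK// fA.
have eN : `|A s t *: a| ^+ 2 = A s t ^+ 2 * `|a| ^+ 2.
  by rewrite normrZ exprMn real_normK ?num_real.
rewrite chain_sumD chain_sumZ (chain_sum_additive addB cl) /B /energy eD eN dotZl -dotE.
have [->|A0] := eqVneq (A s t) 0; first by rewrite invr0; lra.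
rewrite le_eqVlt; apply/orP; left; apply/eqP.
by field; rewrite A0 gt_eqF.
Qed.

Lemma defect_subadditive A f a : additive_itv A -> subadditive_itv (defect A f a).
Proof.
move=> addA p q u pq qu; rewrite /defect (addA p q u)// scalerDl opprD.
have -> : f u - f p = (f q - f p) + (f u - f q) by rewrite [RHS]addrC addrA subrK.
by rewrite addrACA ler_normD.
Qed.

Lemma defect0 A f a p : additive_itv A -> defect A f a p p = 0.
Proof. by move=> addA; rewrite /defect (additive_itv0 p addA) scale0r !subrr normr0. Qed.

(** If x and y had the constant velocities a and b relative to A, the sum would
    be a Riemann sum of the integral of (A t - A p) <a, b> dA; the deviation is
    controlled by the total defects. *)
Lemma dot_slope_le A x y a b K L p t l : additive_itv A ->
  (forall p q, p <= q -> `|y q - y p| <= A p q) ->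
  `|a| <= 1 -> 0 <= dot a b ->
  chain p t l -> chain_sum (defect A x a) p l <= K -> A p t <= L ->
  dot a b * A p t ^+ 2 / 2 <=
  chain_sum (fun p q => dot (x t - x p) (y q - y p)) p l +
  K * A p t + L * chain_sum (defect A y b) p l.
Proof.
move=> addA yA a1 ab0.
have A_ge0 u v : u <= v -> 0 <= A u v by move=> /yA; exact: le_trans.
elim: l p => [|q l IH] p.
  by move=> [_ /= <-] _ _; rewrite additive_itv0//=; lra.
move=> /[dup] cl /chain_cons[pq cl'] hK hL.
have qt := chain_le cl'; have Apt := addA _ _ _ pq qt.
have dx0 : 0 <= defect A x a p q by exact: normr_ge0.
have /= hK' := hK.
have := IH q cl' _ _; rewrite /=.
have /[swap] /[apply] : chain_sum (defect A x a) q l <= K by lra.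
have /[swap] /[apply] : A q t <= L by have := A_ge0 _ _ pq; lra.
set S := chain_sum _ q l; set G := chain_sum _ q l => hI.
have [h1 h2 h3] : [/\ 0 <= A p q, 0 <= A q t & 0 <= A p t] by rewrite !A_ge0// (le_trans pq).
pose rho := x t - x p - A p t *: a.
have rhoK : `|rho| <= K.
  apply: le_trans hK; apply: (@le_chain_sum_subadditive _ (defect A x a) _ _ _ _ _ cl).
    by move=> u; exact: defect0.
  exact: defect_subadditive.
have e1 : dot (x t - x p) (y q - y p) = A p t * dot a (y q - y p) + dot rho (y q - y p).
  by rewrite -dotZl -dotDl /rho [_ *: a + _]addrC subrK.
have e2 : - (K * A p q) <= dot rho (y q - y p).
  apply: le_trans (dot_ge dotE _ _); rewrite lerN2 ler_pM//; exact: yA.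
have e3 : A p q * dot a b - defect A y b p q <= dot a (y q - y p).
  have -> : dot a (y q - y p) = A p q * dot a b + dot a (y q - y p - A p q *: b).
    by rewrite [dot a (_ - _ *: _)]dotBr dotZr; lra.
  have := dot_ge dotE a (y q - y p - A p q *: b); rewrite -/(defect A y b p q).
  have := normr_ge0 (y q - y p - A p q *: b); rewrite -/(defect A y b p q).
  have := normr_ge0 a; nra.
have e4 := ler_wpM2l h3 e3.
have e5 : A p t * defect A y b p q <= L * defect A y b p q.
  by rewrite ler_wpM2r// normr_ge0.
have e6 : 0 <= dot a b * A p q ^+ 2 by rewrite mulr_ge0// sqr_ge0.
rewrite e1; rewrite Apt in e4 e5 h3 *.
have : A p t = A p q + A q t by [].
nra.
Qed.

(** Turns x s - x q at right end points into y t - y p at left end points, with the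
    roles of x and y exchanged. *)
Lemma abel_chain x y s p t l : chain p t l ->
  chain_sum (fun p q => dot (x s - x q) (y q - y p)) p l =
  dot (x s - x p) (y t - y p) + chain_sum (fun p q => dot (y t - y p) (x p - x q)) p l.
Proof.
elim: l p => [|q l IH] p; first by move=> [_ /= <-]; rewrite subrr dot0r addr0.
move=> /chain_cons[pq cl] /=; rewrite IH//.
rewrite [dot _ (x p - x q)]dotC !(dotBl,dotBr); ring.
Qed.

End flatness.

Section energy.
Context {R : realType} {H : normedModType R}.
Implicit Types (f : R -> H) (A : R -> R -> R).

(** Subadditivity is the inequality
    (n1 + n2)^2 / (h1 + h2) <= n1^2 / h1 + n2^2 / h2. *)
Lemma rect_energy A f : additive_itv A ->
  (forall p q, p <= q -> `|f q - f p| <= A p q) -> rectifiable (energy A f).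
Proof.
move=> addA fA.
have A_ge0 p q : p <= q -> 0 <= A p q by move=> /fA; exact: le_trans.
split.
- by move=> p q pq; rewrite divr_ge0 ?sqr_ge0 ?A_ge0.
- by move=> p; rewrite /energy subrr normr0 expr0n mul0r.
- move=> p q s pq qs; rewrite /energy (addA p q s)//.
  have := incr_subadditive f pq qs; rewrite /incr.
  have := fA _ _ pq; have := fA _ _ qs; have := A_ge0 _ _ pq; have := A_ge0 _ _ qs.
  move: (A p q) (A q s) => h1 h2.
  have := normr_ge0 (f q - f p); have := normr_ge0 (f s - f q); have := normr_ge0 (f s - f p).
  move: `|f q - f p| `|f s - f q| `|f s - f p| => n1 n2 n n0 n20 n10 h20 h10 nh2 nh1 nn.
  have [h1E|h1n] := eqVneq h1 0.
    have n1E : n1 = 0 by lra.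
    rewrite n1E h1E in nn *; rewrite expr0n !add0r mul0r add0r.
    by rewrite ler_wpM2r ?invr_ge0// lerXn2r ?nnegrE; lra.
  have [h2E|h2n] := eqVneq h2 0.
    have n2E : n2 = 0 by lra.
    rewrite n2E h2E in nn *; rewrite expr0n !addr0 mul0r addr0.
    by rewrite ler_wpM2r ?invr_ge0// lerXn2r ?nnegrE; lra.
  have h1p : 0 < h1 by rewrite lt_def h1n.
  have h2p : 0 < h2 by rewrite lt_def h2n.
  apply: (@le_trans _ _ ((n1 + n2) ^+ 2 / (h1 + h2))).
    by rewrite ler_wpM2r ?invr_ge0 ?addr_ge0// lerXn2r ?nnegrE ?addr_ge0//; lra.
  rewrite -subr_ge0.
  have -> : n1 ^+ 2 / h1 + n2 ^+ 2 / h2 - (n1 + n2) ^+ 2 / (h1 + h2) =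
    (n1 * h2 - n2 * h1) ^+ 2 / (h1 * h2 * (h1 + h2)).
    by field; rewrite h1n h2n gt_eqF ?addr_gt0.
  by rewrite divr_ge0 ?sqr_ge0// !mulr_ge0 ?addr_ge0.
- apply: (bounded_sums_additive addA) => p q pq; rewrite /energy.
  have [->|An] := eqVneq (A p q) 0; first by rewrite invr0 mulr0.
  have Ap : 0 < A p q by rewrite lt_def An A_ge0.
  by rewrite ler_pdivrMr// -expr2 lerXn2r ?nnegrE ?fA// ltW.
Qed.

End energy.

(** * Orthogonality of the state and the output *)

Section orthogonality.
Context {R : realType} {H : normedModType R}.
Variable dot : {dot H for idfun}.
Hypothesis dotE : forall x : H, `|x| ^+ 2 = dot x x.
Variables (r : R) (Z : set H).
Hypothesis r_gt0 : 0 < r.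

Definition unif_cont (x : R -> H) := forall e, 0 < e -> exists2 d, 0 < d &
  forall p q, p <= q -> q < p + d -> `|x q - x p| <= e.

(** The variational inequality tested with the constant z on ]p, q], where x stays
    within w of c. It contains no integral and can be summed over subdivisions. *)
Definition play_ineq (x y : R -> H) := forall p q c w z, p <= q -> Z z ->
  (forall t, p <= t -> t <= q -> `|x t - c| <= w) ->
  dot (z - c) (y q - y p) <= ((`|z - c| + w) ^+ 2 / (2 * r) + w) * tvar y p q.

Variables x y : R -> H.
Hypotheses (bx : locBV x) (by_ : locBV y) (cx : unif_cont x).
Hypotheses (Zx : forall t, Z (x t)) (xy : play_ineq x y).

Let A p q := tvar x p q + tvar y p q.
Let e0 p q := energy A x p q + energy A y p q.

Let addA : additive_itv A.
Proof. by apply: additive_itvD; exact: tvar_additive. Qed.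

Let xA p q : p <= q -> `|x q - x p| <= A p q.
Proof. by move=> pq; rewrite (le_trans (le_tvar bx pq))// lerDl tvar_ge0. Qed.

Let yA p q : p <= q -> `|y q - y p| <= A p q.
Proof. by move=> pq; rewrite (le_trans (le_tvar by_ pq))// lerDr tvar_ge0. Qed.

Let A_ge0 p q : p <= q -> 0 <= A p q.
Proof. by move=> /xA; exact: le_trans. Qed.

Let rect_e0 : rectifiable e0.
Proof.
by apply: rectifiableD; apply: rect_energy; [exact: addA|exact: xA|exact: addA|exact: yA].
Qed.

(** On a fine subdivision the oscillation of x is negligible with respect to
    A s t, so that only the quadratic term of the inequality is left. *)
Lemma riemann_sum_le s t w z (g : R -> R -> R) : 0 < w ->
  s <= t -> 0 < A s t -> Z z -> (forall p, s <= p -> p <= t -> `|z - x p| <= w) ->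
  (forall p, s <= p -> p <= t -> `|z - x p| <= A s t) ->
  (forall p q, p <= q -> p <= g p q <= q) ->
  exists2 d, 0 < d & forall l, chain s t l -> path (fun a b => b < a + d) s l ->
    chain_sum (fun p q => dot (z - x (g p q)) (y q - y p)) s l <= w * A s t ^+ 2 / r.
Proof.
move=> w0 st L0 Zz zw zL gp; set L := A s t in L0 zL *.
have c0 : 0 < 3 * w / (2 * r) + 1 by rewrite addr_gt0// divr_gt0 ?mulr_gt0.
(* The oscillation w' is so small that it contributes at most half of the bound. *)
pose w' := Num.min w (w * L / (2 * r) / (3 * w / (2 * r) + 1)).
have w'0 : 0 < w' by rewrite lt_min w0/= !divr_gt0 ?mulr_gt0.
have w'w : w' <= w by rewrite ge_min lexx.
have w'L : w' * (3 * w / (2 * r) + 1) <= w * L / (2 * r).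
  by rewrite -ler_pdivlMr// ge_min lexx orbT.
have [d d0 xd] := cx w'0; exists d => // l cl fl.
apply: (@le_trans _ _ (chain_sum (fun p q => (w * L / r) * tvar y p q) s l)).
  apply: (ler_chain_sum_path cl fl) => p q sp pq qt qd.
  have /andP[g1 g2] := gp _ _ pq.
  apply: le_trans (xy (w := w') pq Zz _) _.
    move=> u pu uq; have [gu|/ltW ug] := leP (g p q) u.
      by apply: xd => //; lra.
    by rewrite distrC; apply: xd => //; lra.
  rewrite ler_wpM2r ?tvar_ge0//.
  have sg : s <= g p q by lra.
  have gt : g p q <= t by lra.
  have := zw _ sg gt; have := zL _ sg gt; have := normr_ge0 (z - x (g p q)).
  move: `|_| => n n0 nL nw.
  have e1 : (n + w') ^+ 2 <= w * L + 3 * w * w'.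
    have : n ^+ 2 <= w * L by rewrite expr2 ler_pM.
    have : n * w' <= w * w' by rewrite ler_wpM2r// ltW.
    have : w' * w' <= w * w' by rewrite ler_wpM2r// ltW.
    lra.
  apply: (@le_trans _ _ ((w * L + 3 * w * w') / (2 * r) + w')).
    by rewrite lerD2r ler_wpM2r// invr_ge0 mulr_ge0// ltW.
  have -> : (w * L + 3 * w * w') / (2 * r) + w' =
    w * L / (2 * r) + w' * (3 * w / (2 * r) + 1) by field; rewrite gt_eqF.
  have -> : w * L / r = w * L / (2 * r) + w * L / (2 * r) by field; rewrite gt_eqF.
  by rewrite lerD2l.
rewrite chain_sumZ (chain_sum_additive (tvar_additive by_) cl).
have -> : w * L ^+ 2 / r = w * L / r * L by field; rewrite gt_eqF.
apply: ler_wpM2l; first by rewrite divr_ge0 ?mulr_ge0// ltW.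
by rewrite /L /A lerDr tvar_ge0.
Qed.

(** The integral of <x t - x, dy> over [s, t] is about <a, b> A^2 / 2, that of
    <x s - x, dy> is about - <a, b> A^2 / 2, and the inequality bounds both from
    above. The error is what the energy of [s, t] can still gain by refinement. *)
Lemma dot_slopes_le k w s t : 0 < k -> 0 < w -> s <= t ->
  (forall p q, s <= p -> p <= q -> q <= t -> `|x q - x p| <= w) ->
  `|dot (slope A x s t) (slope A y s t)| * A s t <=
  (4 * k + 2 * w / r) * A s t + (2 * k)^-1 * (total_sum e0 s t - e0 s t).
Proof.
move=> k0 w0 st xw; set a := slope A x s t; set b := slope A y s t.
set L := A s t.
have D0 : 0 <= total_sum e0 s t - e0 s t.
  by rewrite subr_ge0; apply: le_total_sum => //; exact: rect_e0.
have D0' : 0 <= (2 * k)^-1 * (total_sum e0 s t - e0 s t).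
  by rewrite mulr_ge0// invr_ge0 mulr_ge0// ltW.
have [LE|Ln] := eqVneq L 0; first by rewrite LE !mulr0 add0r.
have L0 : 0 < L by rewrite lt_def Ln A_ge0.
have xtL p : s <= p -> p <= t -> `|x t - x p| <= L.
  move=> sp pt; apply: le_trans (xA pt) _.
  by rewrite /L (addA sp pt) lerDr A_ge0.
have xsL p : s <= p -> p <= t -> `|x s - x p| <= L.
  move=> sp pt; rewrite distrC; apply: le_trans (xA sp) _.
  by rewrite /L (addA sp pt) lerDl A_ge0.
have xtw p : s <= p -> p <= t -> `|x t - x p| <= w by move=> sp pt; exact: xw.
have xsw p : s <= p -> p <= t -> `|x s - x p| <= w.
  by move=> sp pt; rewrite distrC; exact: xw.
have [d1 d10 R1] := riemann_sum_le (g := fun p q => p) w0 st L0 (Zx t) xtw xtL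
  (fun p q pq => ltac:(by rewrite lexx pq)).
have [d2 d20 R2] := riemann_sum_le (g := fun p q => q) w0 st L0 (Zx s) xsw xsL
  (fun p q pq => ltac:(by rewrite lexx pq)).
have d0 : 0 < Num.min d1 d2 by rewrite lt_min d10.
have [l cl fl] := exists_fine_chain d0 st.
have fl1 : path (fun u v => v < u + d1) s l.
  by apply: sub_path fl => u v /lt_le_trans; apply; rewrite lerD2l ge_min lexx.
have fl2 : path (fun u v => v < u + d2) s l.
  by apply: sub_path fl => u v /lt_le_trans; apply; rewrite lerD2l ge_min lexx orbT.
have {fl1}R1 := R1 l cl fl1; have {fl2}R2 := R2 l cl fl2.
have Gx := chain_sum_defect_le dotE addA xA k0 cl; rewrite -/a in Gx.
have Gy := chain_sum_defect_le dotE addA yA k0 cl; rewrite -/b in Gy.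
have E0 : chain_sum (energy A x) s l + chain_sum (energy A y) s l <= total_sum e0 s t.
  by rewrite -chain_sumD; apply: chain_sum_le_total_sum => //; exact: rect_e0.
set gx := chain_sum (defect A x a) s l in Gx; set gy := chain_sum (defect A y b) s l in Gy.
have Gxy : gx + gy <= 2 * k * L + (4 * k)^-1 * (total_sum e0 s t - e0 s t).
  apply: le_trans (lerD Gx Gy) _.
  rewrite -/L /e0; set m := (4 * k)^-1.
  have m0 : 0 <= m by rewrite invr_ge0 mulr_ge0// ltW.
  by have := ler_wpM2l m0 E0; lra.
suff : `|dot a b| * L <= 2 * (w * L / r + gx + gy).
  have -> : (2 * k)^-1 = 2 * (4 * k)^-1 by field; rewrite gt_eqF.
  have -> : (4 * k + 2 * w / r) * L = 2 * (w * L / r) + 4 * k * L by field; rewrite gt_eqF.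
  lra.
have a1 : `|a| <= 1 by apply: norm_slope_le1; exact: xA.
have b1 : `|b| <= 1 by apply: norm_slope_le1; exact: yA.
have fin c S : 0 <= c -> S <= w * L ^+ 2 / r ->
    c * L ^+ 2 / 2 <= S + gx * L + L * gy -> c * L <= 2 * (w * L / r + gx + gy).
  move=> c0 SL h; rewrite -(ler_pM2r L0).
  have -> : 2 * (w * L / r + gx + gy) * L = 2 * (w * L ^+ 2 / r + gx * L + L * gy).
    by field; rewrite gt_eqF.
  have -> : c * L * L = 2 * (c * L ^+ 2 / 2) by field.
  lra.
have [c0|c0] := leP 0 (dot a b).
  rewrite ger0_norm//; apply: (fin _ _ c0 R1).
  exact: (dot_slope_le dotE addA yA a1 c0 cl (lexx _) (lexx _)).
have c0' : 0 <= dot b (- a) by rewrite dotNr dotC; lra.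
rewrite ltr0_norm// (dotC dot a) -(dotNr dot).
apply: (fin _ _ c0' R2).
rewrite (abel_chain dot x y s cl) subrr dot0l add0r.
have := @dot_slope_le _ _ dot dotE A y (fun t => - x t) b (- a) gy L s t l addA _ b1 c0' cl
  (lexx _) (lexx _).
have -> : chain_sum (defect A (fun t => - x t) (- a)) s l = gx.
  rewrite /gx; congr chain_sum; apply/funext => p; apply/funext => q.
  by rewrite /defect -normrN !(scalerN, opprD, opprK).
have -> : chain_sum (fun p q => dot (y t - y p) (- x q - - x p)) s l =
          chain_sum (fun p q => dot (y t - y p) (x p - x q)) s l.
  by congr chain_sum; apply/funext => p; apply/funext => q; rewrite opprK [- x q + _]addrC.
have nxA p q : p <= q -> `|- x q - - x p| <= A p q.
  by move=> pq; rewrite -normrN opprD !opprK xA.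
rewrite -/L => h.
set S := chain_sum _ s l in h *; have {h} := h nxA; lra.
Qed.


(** The squares of the two norms differ by 4 <a, b>, and
    (P - Q)^2 <= P^2 - Q^2 for 0 <= Q <= P. *)
Lemma norm_reflect_le k m (a b : H) : `|k| = 1 -> 0 < m ->
  `|a + k *: b| <= `|a + (- k) *: b| + m + `|dot a b| / m.
Proof.
move=> k1 m0; have [|QP] := leP `|a + k *: b| `|a + (- k) *: b|.
  move=> /le_trans; apply; rewrite -addrA lerDl addr_ge0// ?divr_ge0// ltW//.
have PQ2 : `|a + k *: b| ^+ 2 - `|a + (- k) *: b| ^+ 2 <= 4 * `|dot a b|.
  rewrite !(sqr_normD dotE) !dotZr !normrZ normrN.
  have : k * dot a b <= `|dot a b|.
    by rewrite -[leRHS]mul1r -k1 -normrM ler_norm.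
  lra.
move: QP PQ2; have := normr_ge0 (a + (- k) *: b).
move: `|a + k *: b| `|a + (- k) *: b| `|dot a b| => P Q c Q0 QP PQ2.
rewrite -lerBlDl ler_pdivlMr//.
have : 0 <= (P - Q - 2 * m) ^+ 2 by exact: sqr_ge0.
have : 0 <= Q * (P - Q) by rewrite mulr_ge0// subr_ge0 ltW.
rewrite !expr2 in PQ2 *; lra.
Qed.

(** On most short intervals x and y have almost constant velocities, and these
    are almost orthogonal, so that reflecting y hardly changes the length of
    the increment; the exceptional intervals are those where the energy can
    still be increased, and there are few of these. *)
Lemma incr_reflect_le k p q : `|k| = 1 -> p <= q ->
  incr (fun t => x t + k *: y t) p q <= tvar (fun t => x t + (- k) *: y t) p q.
Proof.
move=> k1 pq.
have bp : locBV (fun t => x t + k *: y t) by exact: locBV_lin.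
have bm : locBV (fun t => x t + (- k) *: y t) by exact: locBV_lin.
set f := (fun t => x t + k *: y t) in bp *.
set g := (fun t => x t + (- k) *: y t) in bm *.
suff Pn n : 0 < n -> incr f p q <= tvar g p q + n * A p q.
  apply/ler_addgt0Pr => e e_gt0; have A0 := A_ge0 pq.
  apply: le_trans (Pn (e / (A p q + 1)) _) _; first by rewrite divr_gt0// ltr_wpDl.
  rewrite lerD2l mulrAC ler_pdivrMr ?ltr_wpDl// ler_wpM2l// ?lerDl// ltW//.
(* The errors m, 4 j / m and 2 w / (r m) each amount to n / 3. *)
move=> n0; pose m := n / 3; pose j := n * m / 12; pose w := n * r * m / 6.
have m0 : 0 < m by rewrite divr_gt0.
have j0 : 0 < j by rewrite divr_gt0// mulr_gt0.
have w0 : 0 < w by rewrite divr_gt0// !mulr_gt0.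
have [d d0 xd] := cx w0.
pose K := (2 * j)^-1 / m.
have K0 : 0 < K by rewrite divr_gt0// invr_gt0 mulr_gt0.
pose P a b := incr f a b <= tvar g a b + n * A a b.
apply: (@local_to_global _ P d) => //.
- move=> a; rewrite /P incr0 (additive_itv0 _ addA) (additive_itv0 _ (tvar_additive bm)).
    by rewrite mulr0 addr0.
- move=> a b c ab bc; rewrite /P (addA ab bc) (tvar_additive bm ab bc) => h1 h2.
  have := incr_subadditive f ab bc; lra.
move=> {p q pq} p q pq qd.
pose B a b := tvar g a b + (n * A a b + K * total_sum e0 a b).
have addB : additive_itv B.
  apply: additive_itvD; first exact: tvar_additive.
  apply: additive_itvD; first by apply: additive_itvZ; exact: addA.
  by apply: additive_itvZ; apply: total_sum_additive; exact: rect_e0.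
have cell a b : p <= a -> a <= b -> b <= q -> incr f a b + K * e0 a b <= B a b.
  move=> pa ab bq.
  have osc u v : a <= u -> u <= v -> v <= b -> `|x v - x u| <= w.
    by move=> au uv vb; apply: xd => //; lra.
  have := dot_slopes_le j0 w0 ab osc.
  set sa := slope A x a b; set sb := slope A y a b => hd.
  have vE c : incr (fun t => x t + c *: y t) a b = A a b * `|sa + c *: sb|.
    rewrite -[X in X * _](ger0_norm (A_ge0 ab)) -normrZ scalerDr.
    rewrite [A a b *: (c *: sb)]scalerA [A a b * c]mulrC -[(c * _) *: sb]scalerA.
    rewrite !slopeK ?xA ?yA// /incr opprD addrACA.
    by rewrite -scalerBr.
  have fE : incr f a b = A a b * `|sa + k *: sb| by exact: vE.
  have gE : incr g a b = A a b * `|sa + (- k) *: sb| by exact: vE.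
  have := ler_wpM2l (A_ge0 ab) (norm_reflect_le sa sb k1 m0).
  rewrite !mulrDr -fE -gE.
  have := le_tvar bm ab; rewrite -/(incr g a b).
  have : A a b * (`|dot sa sb| / m) <=
      ((4 * j + 2 * w / r) * A a b + (2 * j)^-1 * (total_sum e0 a b - e0 a b)) / m.
    by rewrite mulrA ler_pM2r ?invr_gt0// mulrC.
  have -> : ((4 * j + 2 * w / r) * A a b + (2 * j)^-1 * (total_sum e0 a b - e0 a b)) / m
     = (n / 3 + n / 3) * A a b + K * (total_sum e0 a b - e0 a b).
    by rewrite /K /w /j; field; rewrite !gt_eqF.
  by rewrite /B /m /e0; lra.
have : K * total_sum e0 p q <= B p q - incr f p q.
  rewrite -ler_pdivlMl//; apply: total_sum_le => // l cl.
  rewrite ler_pdivlMl// -chain_sumZ lerBrDl.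
  apply: (@le_trans _ _ (chain_sum (fun a b => incr f a b + K * e0 a b) p l)).
    rewrite chain_sumD lerD2r.
    exact: (le_chain_sum_subadditive (incr0 f) (@incr_subadditive _ _ f) cl).
  by rewrite -(chain_sum_additive addB cl); apply: ler_chain_sum cl cell.
by rewrite /B /P; lra.
Qed.

Lemma tvar_reflect_le k p q : `|k| = 1 -> p <= q ->
  tvar (fun t => x t + k *: y t) p q <= tvar (fun t => x t + (- k) *: y t) p q.
Proof.
move=> k1 pq; apply: total_sum_least => //.
- exact/rect_incr/locBV_lin.
- exact/tvar_additive/locBV_lin.
- by move=> a b _ ab _; exact: incr_reflect_le.
Qed.

End orthogonality.

(** * Uniform stability *)

Section gronwall.
Context {R : realType} {H : normedModType R}.
Variable dot : {dot H for idfun}.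
Hypothesis dotE : forall x : H, `|x| ^+ 2 = dot x x.
Variables (r : R) (Z : set H).
Hypothesis r_gt0 : 0 < r.
Variables x1 y1 x2 y2 : R -> H.
Hypotheses (by1 : locBV y1) (by2 : locBV y2).
Hypotheses (cx1 : unif_cont x1) (cx2 : unif_cont x2).
Hypotheses (cy1 : unif_cont y1) (cy2 : unif_cont y2).
Hypotheses (Zx1 : forall t, Z (x1 t)) (Zx2 : forall t, Z (x2 t)).
Hypotheses (xy1 : play_ineq dot r Z x1 y1) (xy2 : play_ineq dot r Z x2 y2).
Variable d : R.
Hypothesis d_gt0 : 0 < d.
Hypothesis ud : forall t, `|(x1 t + y1 t) - (x2 t + y2 t)| <= d.

Let m p q := tvar y1 p q + tvar y2 p q.
Let w t := y1 t - y2 t.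
Let k := 2 * r * d + 4 * d ^+ 2.

(** Testing each inequality with the state of the other solution shows that
    |y1 - y2|^2 + k grows at most at the rate 2 / r with respect to the sum of the
    two variations. On short intervals 1 + t <= exp t closes the estimate. *)
Lemma play_gronwall p q : p <= q ->
  `|y1 q - y2 q| ^+ 2 + k <= (`|y1 p - y2 p| ^+ 2 + k) * expR (2 / r * m p q).
Proof.
have addm : additive_itv m by apply: additive_itvD; exact: tvar_additive.
have m_ge0 a b : a <= b -> 0 <= m a b by move=> ab; rewrite addr_ge0 ?tvar_ge0.
have k0 : 0 <= k by rewrite addr_ge0 ?mulr_ge0 ?sqr_ge0// ltW.
have d2 : 0 < d / 2 by rewrite divr_gt0.
have [e1 e10 h1] := cx1 d2; have [e2 e20 h2] := cx2 d2.
have [e3 e30 h3] := cy1 d2; have [e4 e40 h4] := cy2 d2.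
pose e := Num.min (Num.min e1 e2) (Num.min e3 e4).
pose P a b := `|w b| ^+ 2 + k <= (`|w a| ^+ 2 + k) * expR (2 / r * m a b).
apply: (@local_to_global _ P e).
- by rewrite !lt_min e10 e20 e30 e40.
- by move=> a; rewrite /P additive_itv0// mulr0 expR0 mulr1.
- move=> a b c ab bc; rewrite /P (addm a b c)// [2 / r * (m a b + m b c)]mulrDr expRD => hab hbc.
  by apply: le_trans hbc _; rewrite mulrA ler_pM2r ?expR_gt0.
move=> {p q} p q pq; rewrite -ltrBlDl !lt_min !ltrBlDl.
move=> /andP[/andP[q1 q2] /andP[q3 q4]].
have m0 := m_ge0 _ _ pq.
have := expR_ge1Dx (2 / r * m p q).
rewrite /P => /(ler_wpM2l (addr_ge0 (sqr_ge0 `|w p|) k0)); apply: le_trans.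
set W := `|w p|; have W0 : 0 <= W by exact: normr_ge0.
pose n := `|x2 p - x1 p|.
have nW : n <= W + d.
  have -> : n = `|((x1 p + y1 p) - (x2 p + y2 p)) - w p|.
    by rewrite /n /w opprD addrACA addrK distrC.
  by rewrite (le_trans (ler_normB _ _))// addrC lerD2l.
have n0 : 0 <= n by exact: normr_ge0.
have osc1 t : p <= t -> t <= q -> `|x1 t - x1 p| <= d / 2.
  by move=> pt tq; apply: h1 => //; lra.
have osc2 t : p <= t -> t <= q -> `|x2 t - x2 p| <= d / 2.
  by move=> pt tq; apply: h2 => //; lra.
have i1 := xy1 pq (Zx2 p) osc1; have i2 := xy2 pq (Zx1 p) osc2.
rewrite -/n in i1; rewrite distrC -/n in i2.
set D := (n + d / 2) ^+ 2 / (2 * r) + d / 2 in i1 i2.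
have DW : 2 * D <= (2 * W ^+ 2 + 8 * d ^+ 2) / r + d.
  have -> : 2 * D = (n + d / 2) ^+ 2 / r + d by rewrite /D; field; rewrite gt_eqF.
  rewrite lerD2r ler_pM2r ?invr_gt0//.
  apply: (@le_trans _ _ ((W + 2 * d) ^+ 2)).
    by rewrite lerXn2r ?nnegrE//; lra.
  have := sqr_ge0 (W - 2 * d); lra.
have wq : w q = w p + (w q - w p) by rewrite addrC subrK.
pose dy1 := y1 q - y1 p; pose dy2 := y2 q - y2 p.
have dw : w q - w p = dy1 - dy2 by rewrite /w /dy1 /dy2 !opprD !opprK addrACA.
have dwm : `|w q - w p| <= m p q.
  by rewrite dw (le_trans (ler_normB _ _))// lerD// le_tvar.
have dwd : `|w q - w p| <= d.
  rewrite dw (le_trans (ler_normB _ _))//; have := h3 _ _ pq q3; have := h4 _ _ pq q4.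
  rewrite -/dy1 -/dy2; lra.
have dw2 : `|w q - w p| ^+ 2 <= d * m p q by rewrite expr2 ler_pM.
have wpE : w p = ((x1 p + y1 p) - (x2 p + y2 p)) + (x2 p - x1 p).
  by rewrite opprD [x1 p + y1 p + _]addrACA -[x2 p - x1 p]opprB [RHS]addrAC subrr add0r.
have cross : 2 * dot (w p) (w q - w p) <= 2 * (d * m p q) + 2 * (D * m p q).
  have -> : dot (w p) (w q - w p) = dot ((x1 p + y1 p) - (x2 p + y2 p)) (w q - w p) +
      dot (x2 p - x1 p) dy1 + dot (x1 p - x2 p) dy2.
    rewrite {1}wpE dotDl -[RHS]addrA; congr (_ + _).
    by rewrite dw dotBr -[x1 p - x2 p]opprB dotNl.
  have := dot_le dotE ((x1 p + y1 p) - (x2 p + y2 p)) (w q - w p).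
  have : `|(x1 p + y1 p) - (x2 p + y2 p)| * `|w q - w p| <= d * m p q by rewrite ler_pM.
  by rewrite /m /dy1 /dy2; lra.
have Dm : 2 * D * m p q <= ((2 * W ^+ 2 + 8 * d ^+ 2) / r + d) * m p q.
  by rewrite ler_wpM2r.
rewrite wq (sqr_normD dotE) -/W.
have -> : (W ^+ 2 + k) * (1 + 2 / r * m p q) =
  W ^+ 2 + k + ((2 * W ^+ 2 + 8 * d ^+ 2) / r + d) * m p q + 3 * d * m p q.
  by rewrite /k; field; rewrite gt_eqF.
lra.
Qed.

End gronwall.

(** * Convergence of the total variation *)

Section variation_convergence.
Context {R : realType} {H : normedModType R}.
Variable dot : {dot H for idfun}.
Hypothesis dotE : forall x : H, `|x| ^+ 2 = dot x x.
Implicit Types (f g y u : R -> H) (A : R -> R -> R) (k : R).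

(** The energy never exceeds A, and A - n^2 / A <= 2 (A - n) for 0 <= n <= A. *)
Lemma chain_sum_defect_le_length A f k s t l : additive_itv A ->
  (forall p q, p <= q -> `|f q - f p| <= A p q) -> 0 < k -> chain s t l ->
  chain_sum (defect A f (slope A f s t)) s l <=
  k * A s t + (2 * k)^-1 * (A s t - `|f t - f s|).
Proof.
move=> addA fA k0 cl; apply: le_trans (chain_sum_defect_le dotE addA fA k0 cl) _.
have st := chain_le cl.
have h1 : chain_sum (energy A f) s l <= A s t.
  rewrite -(chain_sum_additive addA cl); apply: (ler_chain_sum cl) => p q _ pq _.
  have := fA _ _ pq; rewrite /energy; have := normr_ge0 (f q - f p).
  move: `|_| (A p q) => n a n0 na.
  have [->|an] := eqVneq a 0; first by rewrite invr0 mulr0.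
  have a0 : 0 < a by rewrite lt_def an; lra.
  by rewrite ler_pdivrMr// -expr2 lerXn2r ?nnegrE//; lra.
have -> : (2 * k)^-1 = (4 * k)^-1 * 2 by field; rewrite gt_eqF.
rewrite lerD2l -mulrA; apply: ler_wpM2l; first by rewrite invr_ge0 mulr_ge0// ltW.
suff : A s t - energy A f s t <= 2 * (A s t - `|f t - f s|) by lra.
have := fA _ _ st; rewrite /energy; have := normr_ge0 (f t - f s).
move: `|_| (A s t) => n a n0 na.
have [aE|an] := eqVneq a 0; first by rewrite aE invr0 mulr0 in na *; lra.
rewrite -subr_ge0.
have -> : 2 * (a - n) - (a - n ^+ 2 / a) = (a - n) ^+ 2 / a by field.
by rewrite divr_ge0 ?sqr_ge0//; lra.
Qed.

(** If the increments of f and g are almost as long as A allows, then f and g have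
    almost constant velocities, hence so has y, and y runs almost straight. *)
Lemma tvar_flat_le A f g y k s t : additive_itv A -> locBV y ->
  (forall p q, p <= q -> `|f q - f p| <= A p q) ->
  (forall p q, p <= q -> `|g q - g p| <= A p q) ->
  (forall t, f t - g t = 2 *: y t) -> 0 < k -> s <= t ->
  tvar y s t <= incr y s t + k * A s t + (4 * k)^-1 * (2 * A s t - incr f s t - incr g s t).
Proof.
move=> addA by_ fA gA fgy k0 st; apply: total_sum_le => // [|l cl]; first exact: rect_incr.
have Gf := chain_sum_defect_le_length addA fA k0 cl.
have Gg := chain_sum_defect_le_length addA gA k0 cl.
set a := slope A f s t in Gf; set b := slope A g s t in Gg.
have dE p q : 2 *: (y q - y p) = (f q - f p) - (g q - g p).
  by rewrite scalerBr -!fgy !opprD !opprK addrACA.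
have yE : A s t * `|a - b| = 2 * incr y s t.
  have A0 : 0 <= A s t by rewrite (le_trans _ (fA _ _ st)).
  rewrite -[X in X * _](ger0_norm A0) -normrZ scalerBr !slopeK ?fA ?gA//.
  by rewrite -dE normrZ ger0_norm.
have addB : additive_itv (fun p q => A p q * `|a - b|).
  by move=> p q u pq qu; rewrite (addA p q u)// mulrDl.
have : 2 * chain_sum (incr y) s l <=
    chain_sum (defect A f a) s l + chain_sum (defect A g b) s l + A s t * `|a - b|.
  rewrite -chain_sumZ -[X in _ + X](chain_sum_additive addB cl) -!chain_sumD.
  apply: (ler_chain_sum cl) => p q _ pq _.
  have A0 : 0 <= A p q by rewrite (le_trans _ (fA _ _ pq)).
  rewrite /incr -[X in X * _](@ger0_norm _ 2)// -normrZ dE.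
  rewrite -[X in _ + X * _](ger0_norm A0) -normrZ /defect.
  have -> : f q - f p - (g q - g p) =
    (f q - f p - A p q *: a) - (g q - g p - A p q *: b) + A p q *: (a - b).
    rewrite scalerBr; move: (f q - f p) (g q - g p) (A p q *: a) (A p q *: b).
    move=> X Y P Q; rewrite [- (Y - Q)]opprD opprK [X - P + _]addrACA -[RHS]addrA.
    by rewrite [- P + Q + _]addrACA addNr subrr !addr0.
  by rewrite (le_trans (ler_normD _ _))// lerD2r ler_normB.
have kE : (2 * k)^-1 = (4 * k)^-1 * 2 by field; rewrite gt_eqF.
rewrite yE; rewrite kE in Gf Gg.
by rewrite /incr in Gf Gg *; lra.
Qed.

Lemma chain_sum_flat_le A f g y k p q l : additive_itv A -> locBV y ->
  (forall p q, p <= q -> `|f q - f p| <= A p q) ->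
  (forall p q, p <= q -> `|g q - g p| <= A p q) ->
  (forall t, f t - g t = 2 *: y t) -> 0 < k -> chain p q l ->
  tvar y p q <= chain_sum (incr y) p l + k * A p q +
    (4 * k)^-1 * (2 * A p q - (chain_sum (incr f) p l + chain_sum (incr g) p l)).
Proof.
move=> addA by_ fA gA fgy k0 cl.
rewrite -(chain_sum_additive (tvar_additive by_) cl).
pose B p q := incr y p q + (k * A p q + (4 * k)^-1 * (2 * A p q + -1 * (incr f p q + incr g p q))).
apply: (@le_trans _ _ (chain_sum B p l)).
  apply: (ler_chain_sum cl) => a b _ ab _.
  by apply: le_trans (tvar_flat_le addA by_ fA gA fgy k0 ab) _; rewrite /B; lra.
rewrite /B 2!chain_sumD 2!chain_sumZ chain_sumD 2!chain_sumZ chain_sumD.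
rewrite (chain_sum_additive addA cl).
by lra.
Qed.

Lemma chain_sum_incr_close f g e p l : (forall t, `|f t - g t| <= e) ->
  chain_sum (incr f) p l <= chain_sum (incr g) p l + 2 * e * (size l)%:R.
Proof.
move=> fg; elim: l p => [|q l IH] p /=; first by rewrite mulr0 addr0.
have := IH q; rewrite -natr1.
suff : incr f p q <= incr g p q + 2 * e by lra.
rewrite /incr.
have -> : f q - f p = (g q - g p) + ((f q - g q) - (f p - g p)).
  move: (f q) (f p) (g q) (g p) => a b c d'.
  rewrite [- (b - d')]opprD opprK [a - c + _]addrACA [RHS]addrCA.
  by rewrite [c - d' + _]addrACA subrr addNr !addr0.
have := ler_normD (g q - g p) ((f q - g q) - (f p - g p)).
have := ler_normB (f q - g q) (f p - g p).
have := fg q; have := fg p; lra.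
Qed.

(** One subdivision is nearly optimal both for u and for its reflection u - 2 y.
    Uniform closeness controls the increments over it, and [chain_sum_flat_le]
    bounds what y' may gain between its points. *)
Lemma tvar_continuous u y p q e : p <= q -> 0 < e -> locBV u -> locBV y ->
  tvar u p q <= tvar (fun t => u t - 2 *: y t) p q ->
  exists2 d, 0 < d & forall u' y', locBV u' -> locBV y' ->
    (forall a b, a <= b ->
      tvar (fun t => u' t - 2 *: y' t) a b <= tvar u' a b) ->
    (forall t, `|u t - u' t| <= d) -> (forall t, `|y t - y' t| <= d) ->
    tvar u' p q <= tvar u p q + d ->
    `|tvar y p q - tvar y' p q| <= e.
Proof.
move=> pq e0 bu by_ uw.
have bw : locBV (fun t => u t - 2 *: y t).
  under eq_fun do rewrite -scaleNr; exact: locBV_lin.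
set w := (fun t => u t - 2 *: y t) in uw bw.
set U := tvar u p q in uw *.
have U0 : 0 <= U by exact: tvar_ge0.
(* The rates of the error: k * U costs at most e / 4, and so does a length defect rho. *)
pose k := e / (4 * (U + 1)); pose rho := k * e.
have k0 : 0 < k by rewrite divr_gt0// mulr_gt0// ltr_wpDl.
have rho0 : 0 < rho by rewrite mulr_gt0.
have rho2 : 0 < rho / 2 by rewrite divr_gt0.
have e2 : 0 < e / 2 by rewrite divr_gt0.
have [l cl hl] := total_sum_approx (rectifiableD (rect_incr bu) (rect_incr bw)) rho2 pq.
have {}hl : 2 * U - rho / 2 <= chain_sum (incr u) p l + chain_sum (incr w) p l.
  rewrite -chain_sumD; have := total_sumD_ge (rect_incr bu) (rect_incr bw) pq.
  rewrite -/(tvar u) -/(tvar w) -/U; lra.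
have [l2 cl2 hl2] := total_sum_approx (rect_incr by_) e2 pq.
pose N : R := (size l)%:R + (size l2)%:R.
have N1 : (size l)%:R <= N by rewrite lerDl.
have N2 : (size l2)%:R <= N by rewrite lerDr.
have N0 : 0 <= N by rewrite addr_ge0.
pose d := Num.min 1 (Num.min (rho / 2 / (2 + 8 * N)) (e / 4 / (2 * (N + 1)))).
have N8 : 0 < 2 + 8 * N by lra.
have N3 : 0 < 2 * (N + 1) by lra.
have d_gt0 : 0 < d by rewrite !lt_min ltr01 !divr_gt0.
exists d => // u' y' bu' by' uw' ud yd Ud.
have dle1 : d <= 1 by rewrite ge_min lexx.
have drho : d * (2 + 8 * N) <= rho / 2.
  by rewrite -ler_pdivlMr ?ge_min ?lexx ?orbT//; lra.
have de : d * (2 * (N + 1)) <= e / 4.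
  by rewrite -ler_pdivlMr ?ge_min ?lexx ?orbT//; lra.
pose w' t := u' t - 2 *: y' t.
have wd t : `|w t - w' t| <= 3 * d.
  have -> : w t - w' t = (u t - u' t) - 2 *: (y t - y' t).
    by rewrite /w /w' scalerBr !opprD !opprK addrACA.
  rewrite (le_trans (ler_normB _ _))// normrZ ger0_norm//.
  by have := ud t; have := yd t; lra.
have bw' : locBV w'.
  rewrite /w'; under eq_fun do rewrite -scaleNr; exact: locBV_lin.
have hy1 := chain_sum_incr_close p l (fun t => ltac:(rewrite distrC; exact: yd t)).
have hy2 := chain_sum_incr_close p l2 yd.
have hu := chain_sum_incr_close p l ud.
have hw := chain_sum_incr_close p l wd.
have dN1 : d * (size l)%:R <= d * N by rewrite ler_wpM2l// ltW.
have dN2 : d * (size l2)%:R <= d * N by rewrite ler_wpM2l// ltW.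
have up := chain_sum_flat_le (tvar_additive bu') by' (fun a b ab => le_tvar bu' ab)
  (fun a b ab => le_trans (le_tvar bw' ab) (uw' a b ab))
  (fun t => ltac:(by rewrite /w' opprB addrC subrK)) k0 cl.
have hyl := chain_sum_le_total_sum (rect_incr by_) cl.
have hyl2 := chain_sum_le_total_sum (rect_incr by') cl2.
rewrite -/(tvar y p q) -/(tvar y' p q) in hyl hyl2 hl2.
have kU : k * tvar u' p q <= e / 4.
  apply: (@le_trans _ _ (k * (U + 1))); first by rewrite ler_wpM2l ?(ltW k0)//; lra.
  by rewrite /k le_eqVlt; apply/orP; left; apply/eqP; field; rewrite gt_eqF// ltr_wpDl.
have hrest : (4 * k)^-1 * (2 * tvar u' p q - (chain_sum (incr u') p l + chain_sum (incr w') p l)) <= e / 4.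
  have k4 : 0 < 4 * k by rewrite mulr_gt0.
  rewrite ler_pdivrMl//; have -> : 4 * k * (e / 4) = rho by rewrite /rho; field.
  lra.
rewrite ler_norml; apply/andP; split; lra.
Qed.

End variation_convergence.

(** * Stieltjes measures of variation functions *)

Section right_continuity.
Context {R : realType} {H : normedModType R}.
Implicit Types f : R -> H.

(** Inside the first proper interval of a nearly optimal subdivision, an initial
    piece cannot vary by much more than its increment. *)
Lemma tvar_chain_start f p s l e : locBV f -> p < s -> chain p s l ->
  tvar f p s - e < chain_sum (incr f) p l ->
  exists2 a, p < a & forall q, p <= q -> q <= a -> tvar f p q < e + incr f p q.
Proof.
move=> bf; elim: l => [|a l IH] ps; first by move=> [_ /= pE]; rewrite pE ltxx in ps.
move=> /chain_cons[pa cl] h; have [ap|pa'] := leP a p.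
  have aE : a = p by apply/eqP; rewrite eq_le ap pa.
  by apply: IH => //; move: cl h; rewrite aE /= incr0 add0r.
exists a => // q pq qa; have := chain_sum_le_total_sum (rect_incr bf) cl.
have as_ := chain_le cl; have := le_tvar bf qa; have := incr_subadditive f pq qa.
have := tvar_additive bf pq (le_trans qa as_); have := tvar_additive bf qa as_.
move: h; rewrite /= -/(tvar f a s) -/(incr f q a); lra.
Qed.

Lemma tvar_right_small f p e : locBV f -> unif_cont f -> 0 < e ->
  exists2 d, 0 < d & forall q, p <= q -> q < p + d -> tvar f p q <= e.
Proof.
move=> bf cf e0; have e2 : 0 < e / 2 by rewrite divr_gt0.
have ps : p < p + 1 by rewrite ltrDl.
have [l cl hl] := total_sum_approx (rect_incr bf) e2 (ltW ps).
have [a pa ha] := tvar_chain_start bf ps cl hl.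
have [d d0 hd] := cf _ e2.
exists (Num.min d (a - p)); first by rewrite lt_min d0 subr_gt0.
move=> q pq; rewrite -ltrBlDl lt_min !ltrBlDl => /andP[q1]; rewrite addrC subrK => /ltW q2.
by have := ha _ pq q2; have := hd _ _ pq q1; rewrite /incr; lra.
Qed.

End right_continuity.

Section stieltjes.
Context {R : realType}.
Implicit Types (F : R -> R) (T c d t : R).

(** Functions on [0, T] are extended to the line by their values at the end points, so
    that no estimate on subdivisions needs a condition on the domain. *)
Definition clamp T t := Num.max 0 (Num.min t T).

Lemma clamp_id T t : 0 <= t -> t <= T -> clamp T t = t.
Proof. by move=> t0 tT; rewrite /clamp (min_idPl tT) (max_idPr t0). Qed.

Lemma clamp_ge0 T t : 0 <= clamp T t.
Proof. by rewrite le_max lexx. Qed.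

Lemma clamp_leT T t : 0 <= T -> clamp T t <= T.
Proof. by move=> T0; rewrite ge_max T0 ge_min lexx orbT. Qed.

Lemma clamp_itv T t : 0 <= T -> clamp T t \in `[0, T].
Proof. by move=> T0; rewrite in_itv/= clamp_ge0 clamp_leT. Qed.

Lemma clamp_le0 T t : t <= 0 -> 0 <= T -> clamp T t = 0.
Proof.
by move=> t0 T0; apply: max_idPl; rewrite ge_min t0.
Qed.

Lemma clamp_geT T t : T <= t -> 0 <= T -> clamp T t = T.
Proof. by move=> tT T0; rewrite /clamp (min_idPr tT) (max_idPr T0). Qed.

Lemma le_clamp T : {homo clamp T : s t / s <= t}.
Proof.
by move=> s t st; rewrite /clamp ge_max le_max lexx/= le_max le_min !ge_min st lexx ?orbT.
Qed.

Lemma clamp_dist T s t : s <= t -> clamp T t - clamp T s <= t - s.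
Proof.
move=> st; rewrite /clamp /Num.max /Num.min.
by case: (ltP t T) => ?; case: (ltP s T) => ?; repeat (case: (@ltP _ R) => ?); lra.
Qed.

Lemma stieltjes_measure_itvoc (f : cumulative R R) c d : c <= d ->
  lebesgue_stieltjes_measure f `]c, d]%classic = (f d - f c)%:E.
Proof.
move=> cd; rewrite /lebesgue_stieltjes_measure/= /measure_extension/=.
rewrite measurable_mu_extE//=; last exact: is_ocitv.
by rewrite wlength_itv_bnd.
Qed.

(** As F is constant outside of [0, T], the Stieltjes measure of F may be restricted
    to ]-1, T], which makes it finite. *)
Lemma stieltjes_measure_exists F T : 0 < T ->
  {homo F : s t / s <= t} -> right_continuous F -> (forall t, F (clamp T t) = F t) ->
  exists lam : {measure set (measurableTypeR R) -> \bar R},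
    (forall c d, c <= d -> lam `]c, d]%classic = (F d - F c)%:E) /\
    lam setT = (F T - F 0)%:E.
Proof.
move=> T0 ndF rcF FT.
pose cF : cumulative R R := HB.pack F (isCumulative.Build R _ R F ndF rcF).
pose D : set (measurableTypeR R) := `]-1, T]%classic.
have mD : measurable D by exact: measurable_itv.
have LS c d : c <= d -> lebesgue_stieltjes_measure cF `]c, d]%classic = (F d - F c)%:E.
  exact: stieltjes_measure_itvoc.
have F1 : F (-1) = F 0 by rewrite -(FT (-1)) -(FT 0) !clamp_le0// ltW.
exists (mrestr (lebesgue_stieltjes_measure cF) mD); split; last first.
  rewrite /= /mrestr setTI LS ?F1//; lra.
move=> c d cd; rewrite /= /mrestr.
pose c' := Num.max c (-1); pose d' := Num.min d T.
have -> : (`]c, d]%classic : set R) `&` D = `]c', d']%classic.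
  apply/seteqP; split=> t /=; rewrite /D /= !in_itv/= gt_max le_min.
    by move=> [/andP[-> ->] /andP[-> ->]].
  by move=> /andP[/andP[-> ->] /andP[-> ->]].
have Fc : F (Num.min c' d') = F c.
  rewrite -FT -[in RHS]FT; congr F; have T0' := ltW T0.
  have [c1|/ltW c1] := leP c (-1).
    rewrite !clamp_le0//; first lra.
    by rewrite ge_min /c' (max_idPr c1); apply/orP; left; lra.
  rewrite /c' (max_idPl c1) /d'; have [dT|Td] := leP d T.
    by rewrite (min_idPl cd).
  by rewrite /clamp -minA minxx.
have Fd : F d' = F d.
  by rewrite -FT -[in RHS]FT /clamp /d' -minA minxx.
have [cd'|dc'] := leP c' d'.
  by rewrite LS// Fd -(min_idPl cd') Fc.
rewrite set_itv_ge ?measure0; last by rewrite bnd_simp -leNgt ltW.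
by rewrite -Fd -Fc (min_idPr (ltW dc')) subrr.
Qed.

End stieltjes.

(** * Total variation of vector measures *)

Section vector_measure_theory.
Context {R : realType} {H : normedModType R}.
Variable mu : set (measurableTypeR R) -> H.
Hypothesis vmu : vector_measure mu.
Implicit Types A B : set (measurableTypeR R).

(** The partial sums of a series with constant term mu set0 converge, hence their
    increments tend to 0. *)
Lemma vector_measure0 : mu set0 = 0.
Proof.
have t0 : trivIset setT (fun _ : nat => set0 : set (measurableTypeR R)).
  by apply/trivIsetP => i j _ _ _; rewrite set0I.
have := vmu (fun _ => measurable0) t0; rewrite bigcup0//.
under eq_fun do rewrite sumr_const card_ord.
move=> h; have h1 := h; rewrite -(cvg_shiftS (fun n => mu set0 *+ n)) in h1.
have hf : (fun _ : nat => mu set0) @ \oo --> mu set0 - mu set0.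
  have -> : (fun _ : nat => mu set0) = (fun n : nat => mu set0 *+ n.+1 - mu set0 *+ n).
    by apply/funext => n; rewrite mulrSr addrAC subrr add0r.
  exact: cvgB h1 h.
rewrite subrr in hf.
by have := @cvg_unique _ (@norm_hausdorff R H) _ _ _ _ (cvg_cst (mu set0)) hf; apply.
Qed.

Lemma vector_measureU A B : measurable A -> measurable B -> A `&` B = set0 ->
  mu (A `|` B) = mu A + mu B.
Proof.
move=> mA mB AB; have mF n : measurable (bigcup2 A B n).
  by case: n => [|[|n]] //=; exact: measurable0.
have tF : trivIset setT (bigcup2 A B) by rewrite -trivIset_bigcup2.
have := vmu mF tF; rewrite bigcup2E => h.
apply: (@cvg_unique _ (@norm_hausdorff R H) _ _ _ _ h).
apply: cvg_near_cst; exists 2%N => // -[|[|n]] //= _.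
by rewrite !big_ord_recl/= big1 ?addr0// => i _; exact: vector_measure0.
Qed.

Lemma vector_measure_setID A B : measurable A -> measurable B ->
  mu A = mu (A `&` B) + mu (A `\` B).
Proof.
move=> mA mB; rewrite -vector_measureU//; first by rewrite setUIDK.
- exact: measurableI.
- exact: measurableD.
- by rewrite setDE setIACA setICr setI0.
Qed.

Lemma tv_measure_ge A F : (forall n, measurable (F n)) -> trivIset setT F ->
  \bigcup_n F n = A ->
  (\sum_(0 <= n <oo) (`|mu (F n)|)%:E <= tv_measure mu A)%E.
Proof. by move=> mF tF FA; apply: ereal_sup_ubound; exists F. Qed.

(** Splitting every member of a partition of A and using the triangle
    inequality. *)
Lemma tv_measure_setID_le A B : measurable B ->
  (tv_measure mu A <= tv_measure mu (A `&` B) + tv_measure mu (A `\` B))%E.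
Proof.
move=> mB; apply: ge_ereal_sup => _ [F [mF tF <- ->]].
have h C : measurable C ->
  (\sum_(0 <= n <oo) (`|mu (F n `&` C)|)%:E <= tv_measure mu (\bigcup_n F n `&` C))%E.
  move=> mC; apply: tv_measure_ge.
  - by move=> n; exact: measurableI.
  - exact: trivIset_setIr.
  - by rewrite setI_bigcupl.
apply: (@le_trans _ _ (\sum_(0 <= n <oo) ((`|mu (F n `&` B)|)%:E + (`|mu (F n `&` ~` B)|)%:E))%E).
  apply: lee_nneseries => [n _|n _]; first by rewrite lee_fin.
  rewrite -EFinD lee_fin [in leLHS](vector_measure_setID (mF n) mB) -setDE.
  exact: ler_normD.
rewrite nneseriesD//.
by rewrite setDE; apply: leeD; apply: h => //; exact: measurableC.
Qed.


(** A partition of B together with A is a partition of the union. *)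
Lemma tv_measure_cons A B : measurable A -> A `&` B = set0 ->
  ((`|mu A|)%:E + tv_measure mu B <= tv_measure mu (A `|` B))%E.
Proof.
move=> mA AB; rewrite -leeBrDl//; apply: ge_ereal_sup => _ [F [mF tF FB ->]].
rewrite leeBrDl//.
pose F' n := if n is m.+1 then F m else A.
have AF n : A `&` F n = set0.
  by apply/seteqP; split=> // t [At Ft]; rewrite -AB; split=> //; rewrite -FB; exists n.
apply: le_trans (@tv_measure_ge _ F' _ _ _).
- rewrite [leRHS]nneseries_recl//= -[X in (_ <= _ + X)%E]nneseries_addn//.
  by under [X in (_ <= _ + X)%E]eq_eseriesr do rewrite addn1.
- by case.
- apply/trivIsetP => -[|i] [|j] //= _ _ ij.
  + by rewrite setIC.
  + by move/trivIsetP : tF; apply.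
- apply/seteqP; split=> t.
    by move=> [[|n] _ Ft]; [left|right; rewrite -FB; exists n].
  by rewrite -FB => -[At|[n _ Ft]]; [exists 0%N|exists n.+1].
Qed.

End vector_measure_theory.

(** * The differential measure of a function of bounded variation *)

Section differential_measure.
Context {R : realType} {H : normedModType R}.
Variable dot : {dot H for idfun}.
Hypothesis dotE : forall x : H, `|x| ^+ 2 = dot x x.
Variables (T : R) (y : R -> H) (mu : set (measurableTypeR R) -> H).
Hypothesis T_gt0 : 0 < T.
Hypothesis dmu : is_differential_measure T y mu.
Let Y t := y (clamp T t).
Hypotheses (bY : locBV Y) (cY : unif_cont Y).
Implicit Types A B : set (measurableTypeR R).

Let vmu : vector_measure mu. Proof. by case: dmu. Qed.
Let T_ge0 : 0 <= T. Proof. exact: ltW. Qed.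

Let Y_clamp t : Y (clamp T t) = Y t.
Proof. by rewrite /Y clamp_id ?clamp_ge0 ?clamp_leT. Qed.

Lemma differential_measure_setT : mu setT = Y T - Y 0.
Proof.
case: dmu => _ muI _ muE; rewrite muI// setTI muE//.
by rewrite /Y !clamp_id.
Qed.

(** Singletons in [0, T] have measure 0, so the left end point does not count. *)
Lemma differential_measure_itvoc c d : c <= d -> mu `]c, d]%classic = Y d - Y c.
Proof.
move=> cd; case: dmu => _ muI _ muE; rewrite muI//.
have [d0|d0] := ltP d 0.
  rewrite /Y !clamp_le0 ?subrr//; [|lra|lra].
  rewrite (_ : _ `&` _ = set0) ?vector_measure0//.
  by apply/seteqP; split=> // t /=; rewrite !in_itv/= => -[/andP[_ ?] /andP[? _]]; lra.
have cdd : clamp T d <= d by rewrite /clamp ge_max d0 ge_min lexx.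
have [c0|c0] := ltP c 0.
  rewrite (_ : _ `&` _ = `[0, clamp T d]%classic).
    by rewrite muE ?clamp_ge0 ?clamp_leT// /Y [clamp T c]clamp_le0// ltW.
  apply/seteqP; split=> t /=; rewrite !in_itv/=.
    by rewrite /clamp le_max le_min => -[/andP[_ ->] /andP[-> ->]]; rewrite orbT.
  move=> /andP[t0 td]; rewrite t0 (le_trans td (clamp_leT _ _))//.
  by rewrite (le_trans td cdd); split=> //; rewrite andbT; lra.
have [Tc|cT] := leP T c.
  rewrite /Y !clamp_geT ?subrr//; [|lra].
  rewrite (_ : _ `&` _ = set0) ?vector_measure0//.
  by apply/seteqP; split=> // t /=; rewrite !in_itv/= => -[/andP[? _] /andP[_ ?]]; lra.
have cd' : c <= clamp T d by rewrite /clamp le_max le_min cd (ltW cT) orbT.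
rewrite (_ : _ `&` _ = `]c, clamp T d]%classic); last first.
  apply/seteqP; split=> t /=; rewrite !in_itv/=.
    by rewrite /clamp le_max le_min => -[/andP[-> ->] /andP[_ ->]]; rewrite orbT.
  move=> /andP[ct td]; rewrite ct (le_trans td cdd) (le_trans td (clamp_leT _ _))//.
  by rewrite andbT; split=> //; lra.
have h : mu `[c, clamp T d]%classic = mu `[c, c]%classic + mu `]c, clamp T d]%classic.
  rewrite -vector_measureU//.
    congr mu; apply/seteqP; split=> t /=; rewrite !in_itv/=.
      move=> /andP[ct ->]; rewrite !andbT.
      by have [tc|tc] := leP t c; [left; rewrite ct|right].
    by move=> [/andP[? ?]|/andP[? ?]]; apply/andP; split; lra.
  by apply/seteqP; split=> // t /=; rewrite !in_itv/= => -[/andP[? ?] /andP[? _]]; lra.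
move: h; rewrite !muE ?clamp_leT//; [|lra]; rewrite subrr add0r => <-.
by rewrite /Y (clamp_id c0 (ltW cT)).
Qed.

Lemma tvar_clamp p q : p <= q -> tvar Y (clamp T p) (clamp T q) = tvar Y p q.
Proof.
move=> pq; have cpq := le_clamp T pq; apply/eqP; rewrite eq_le; apply/andP; split.
  have [q0|q0] := leP q 0.
    by rewrite !clamp_le0 ?(le_trans pq)// (additive_itv0 _ (tvar_additive bY)) tvar_ge0.
  have [Tp|pT] := leP T p.
    by rewrite !clamp_geT ?(le_trans Tp)// (additive_itv0 _ (tvar_additive bY)) tvar_ge0.
  have pc : p <= clamp T p by rewrite /clamp le_max le_min lexx (ltW pT) orbT.
  have cq : clamp T q <= q by rewrite /clamp ge_max (ltW q0) ge_min lexx.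
  rewrite (tvar_additive bY pc (le_trans cpq cq)) (tvar_additive bY cpq cq).
  by rewrite addrCA lerDl addr_ge0 ?tvar_ge0.
apply: (@total_sum_least _ _ (rect_incr bY) (fun p q => tvar Y (clamp T p) (clamp T q))) => //.
  by move=> a b c ab bc; rewrite -tvar_additive// le_clamp.
move=> a b _ ab _; rewrite /incr -Y_clamp -[Y a]Y_clamp.
by apply: le_tvar => //; exact: le_clamp.
Qed.

Let F t := tvar Y 0 (clamp T t).

Let FB p q : p <= q -> F q - F p = tvar Y p q.
Proof.
move=> pq; rewrite -tvar_clamp// /F.
have cpq := le_clamp T pq.
by rewrite (tvar_additive bY (clamp_ge0 _ _) cpq) addrAC subrr add0r.
Qed.

(** The function F - <e, Y> is nondecreasing, where F is the variation function of
    Y. Its Stieltjes measure is positive and agrees with lam - <e, mu> on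
    half-open intervals, hence on all Borel sets by Dynkin's theorem. *)
Lemma dot_differential_measure_le (lam : {measure set (measurableTypeR R) -> \bar R}) e A :
  (forall c d, c <= d -> lam `]c, d]%classic = (F d - F c)%:E) ->
  lam setT = (F T - F 0)%:E ->
  `|e| <= 1 -> measurable A -> dot e (mu A) <= fine (lam A).
Proof.
move=> lamE lamT e1 mA.
pose G t := F t - dot e (Y t).
have dY p q : p <= q -> `|dot e (Y q) - dot e (Y p)| <= tvar Y p q.
  move=> pq; rewrite -dotBr; apply: (@le_trans _ _ `|Y q - Y p|); last exact: le_tvar.
  have := dot_le dotE e (Y q - Y p); have := dot_ge dotE e (Y q - Y p).
  have : `|e| * `|Y q - Y p| <= `|Y q - Y p| by rewrite ler_piMl.
  by rewrite ler_norml; move=> *; apply/andP; split; lra.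
have ndG : {homo G : s t / s <= t}.
  move=> s t st; rewrite /G; have := dY s t st; have := FB st.
  by rewrite ler_norml => ? /andP[_ ?]; lra.
have rcG : right_continuous G.
  move=> p; apply/cvgrPdist_le => k k0.
  have k2 : 0 < k / 2 by rewrite divr_gt0.
  have [d d0 hd] := tvar_right_small p bY cY k2.
  near=> q.
  have pq : p <= q by near: q; exact: nbhs_right_ge.
  have qd : q < p + d by near: q; apply: nbhs_right_lt; rewrite ltrDl.
  have h := hd _ pq qd; have := FB pq; have := dY _ _ pq; have := tvar_ge0 bY pq.
  by rewrite /G !ler_norml => ? /andP[? ?] ?; apply/andP; split; lra.
have GT t : G (clamp T t) = G t.
  by rewrite /G /F Y_clamp (clamp_id (clamp_ge0 _ _) (clamp_leT _ _)).
have [kap [kapE kapT]] := stieltjes_measure_exists T_gt0 ndG rcG GT.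
have fin (nu : {measure set (measurableTypeR R) -> \bar R}) (x : R) B : nu setT = x%:E ->
    measurable B -> nu B \is a fin_num.
  move=> nuT mB; rewrite ge0_fin_numE//.
  by apply: (@le_lt_trans _ _ (nu setT)); [apply: le_measure; rewrite ?inE|rewrite nuT ltry].
suff -> : dot e (mu A) = fine (lam A) - fine (kap A) by rewrite gerBl fine_ge0.
pose P B := dot e (mu B) = fine (lam B) - fine (kap B).
suff : forall B, <<s @ocitv R >> B -> P B by apply.
apply: (@dynkin_induction _ (measurableTypeR R)) => //; rewrite /P => {P}.
- exact: ocitvI.
- rewrite differential_measure_setT lamT kapT/= /G dotBr; lra.
- move=> B /ocitvP[->|[x x12 ->]].
    by rewrite (vector_measure0 vmu) !measure0 dot0r subrr.
  have x12' := ltW x12.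
  by rewrite differential_measure_itvoc// lamE// kapE//= /G dotBr; lra.
- move=> B mB hB.
  have tot (nu : {measure set (measurableTypeR R) -> \bar R}) x : nu setT = x%:E ->
      fine (nu (~` B)) = x - fine (nu B).
    move=> nuT; have : nu setT = (nu B + nu (~` B))%E.
      by rewrite -measureU ?setUCr ?setICr//; exact: measurableC.
    rewrite nuT.
    rewrite -[in X in _ = X -> _](fineK (fin nu x B nuT mB)).
    rewrite -[nu (~` B)](fineK (fin nu x _ nuT (measurableC mB))) -EFinD => -[->].
    by rewrite addrAC subrr add0r.
  rewrite (tot _ _ lamT) (tot _ _ kapT).
  have : mu setT = mu B + mu (~` B).
    by rewrite -vector_measureU ?setUCr ?setICr//; exact: measurableC.
  rewrite differential_measure_setT => /(congr1 (dot e)).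
  by rewrite dotBr dotDr /G; lra.
- move=> B mB tB hB.
  have cv (nu : {measure set (measurableTypeR R) -> \bar R}) x : nu setT = x%:E ->
      (fun n => \sum_(i < n) fine (nu (B i))) @ \oo --> fine (nu (\bigcup_n B n)).
    move=> nuT; have nuf n : nu (B n) \is a fin_num by exact: (fin nu x).
    have mU : measurable (\bigcup_n B n) by exact: bigcupT_measurable.
    have -> : (fun n => \sum_(i < n) fine (nu (B i))) =
        fine \o (fun n => \sum_(0 <= i < n) nu (B i))%E.
      by apply/funext => n /=; rewrite -sum_fine// big_mkord.
    by apply: fine_cvg; rewrite (fineK (fin nu x _ nuT mU)); exact: measure_sigma_additive.
  have h1 : (fun n => dot e (\sum_(i < n) mu (B i))) @ \oo --> dot e (mu (\bigcup_n B n)).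
    have := vmu mB tB => /cvgrPdist_le hv; apply/cvgrPdist_le => k k0.
    near=> n; have hn : `|mu (\bigcup_n B n) - \sum_(i < n) mu (B i)| <= k.
      by near: n; exact: hv.
    rewrite -dotBr; set a := mu _ - _ in hn *.
    have : `|e| * `|a| <= `|a| by rewrite ler_piMl.
    have := dot_le dotE e a; have := dot_ge dotE e a.
    by rewrite ler_norml; move=> *; apply/andP; split; lra.
  have h2 := cvgB (cv _ _ lamT) (cv _ _ kapT).
  apply: (@cvg_unique _ (@norm_hausdorff R R) _ _ _ _ h1).
  have -> : (fun n => dot e (\sum_(i < n) mu (B i))) =
      (fun n => \sum_(i < n) fine (lam (B i)) - \sum_(i < n) fine (kap (B i))).
    apply/funext => n; rewrite (big_morph (dot e) (dotDr dot e) (dot0r dot e)) -sumrB.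
    by apply: eq_bigr => i _; rewrite hB.
  exact: h2.
Unshelve. all: by end_near.
Qed.


Lemma chain_sum_le_tv_measure p l : chain p T l ->
  ((chain_sum (incr Y) p l)%:E <= tv_measure mu `]p, T]%classic)%E.
Proof.
elim: l p => [|a l IH] p.
  move=> [_ /= ->]; rewrite set_itv_ge ?bnd_simp ?ltxx//.
  have tF : trivIset setT (fun _ : nat => set0 : set (measurableTypeR R)).
    by apply/trivIsetP => i j _ _ _; rewrite set0I.
  apply: le_trans (tv_measure_ge mu (fun _ => measurable0) tF (bigcup0 (fun _ _ => erefl))).
  by apply: nneseries_ge0 => n _ _; rewrite lee_fin.
move=> /chain_cons[pa cl] /=; have aT := chain_le cl.
have mI : measurable (`]p, a]%classic : set (measurableTypeR R)) by exact: measurable_itv.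
have I0 : (`]p, a]%classic : set (measurableTypeR R)) `&` `]a, T]%classic = set0.
  by apply/seteqP; split=> // t /=; rewrite !in_itv/= => -[/andP[_ ?] /andP[? _]]; lra.
have := tv_measure_cons mu mI I0.
have -> : (`]p, a]%classic : set (measurableTypeR R)) `|` `]a, T]%classic = `]p, T]%classic.
  apply/seteqP; split=> t /=; rewrite !in_itv/=; last first.
    by move=> /andP[-> ->]; have [ta|ta] := leP t a; [left|right].
  by move=> [/andP[-> ta]|/andP[ta ->]]; rewrite ?andbT ?(le_trans ta)// (le_lt_trans pa).
apply: le_trans.
by rewrite EFinD leeD ?IH// differential_measure_itvoc.
Qed.

(** As lam dominates mu, it dominates the total variation of mu. Subdivisions of
    [0, T] show that both have the same total mass; as the total variation is
    subadditive on a set and its complement, they agree on both. *)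
Lemma tv_measure_stieltjes :
  exists lam : {measure set (measurableTypeR R) -> \bar R},
    [/\ forall A, measurable A -> tv_measure mu A = lam A,
        forall c d, c <= d -> lam `]c, d]%classic = (tvar Y c d)%:E,
        (lam setT < +oo)%E &
        forall A, measurable A -> (`|mu A|%:E <= lam A)%E].
Proof.
have ndF : {homo F : s t / s <= t}.
  by move=> s t st; have := FB st; have := tvar_ge0 bY st; lra.
have rcF : right_continuous F.
  move=> p; apply/cvgrPdist_le => k k0.
  have [d d0 hd] := tvar_right_small p bY cY k0.
  near=> q.
  have pq : p <= q by near: q; exact: nbhs_right_ge.
  have qd : q < p + d by near: q; apply: nbhs_right_lt; rewrite ltrDl.
  have h := hd _ pq qd; have := FB pq; have := tvar_ge0 bY pq.
  by rewrite !ler_norml => *; apply/andP; split; lra.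
have FT t : F (clamp T t) = F t.
  by rewrite /F (clamp_id (clamp_ge0 _ _) (clamp_leT _ _)).
have [lam [lamE lamT]] := stieltjes_measure_exists T_gt0 ndF rcF FT.
have lamf A : measurable A -> lam A \is a fin_num.
  move=> mA; rewrite ge0_fin_numE//.
  by apply: (@le_lt_trans _ _ (lam setT)); [apply: le_measure; rewrite ?inE|rewrite lamT ltry].
have mulam A : measurable A -> (`|mu A|%:E <= lam A)%E.
  move=> mA; have [e e1 <-] := norm_le_dot dotE (mu A).
  by rewrite -(fineK (lamf A mA)) lee_fin; apply: dot_differential_measure_le.
have tvlam A : measurable A -> (tv_measure mu A <= lam A)%E.
  move=> mA; apply: ge_ereal_sup => _ [B [mB tB <- ->]].
  rewrite measure_semi_bigcup//; last exact: bigcupT_measurable.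
  by apply: lee_nneseries => n *; rewrite ?lee_fin//; exact: mulam.
have tvT : (lam setT <= tv_measure mu setT)%E.
  have mI : measurable (`]0, T]%classic : set (measurableTypeR R)) by exact: measurable_itv.
  have := tv_measure_cons mu (measurableC mI) (setICl _).
  rewrite setUC setUCr; apply: le_trans; rewrite lamT FB//.
  have fT : tv_measure mu `]0, T]%classic \is a fin_num.
    rewrite ge0_fin_numE.
      by apply: le_lt_trans (tvlam _ mI) _; rewrite ltey_eq lamf.
    have := chain_sum_le_tv_measure (chain_seq1 T_ge0); apply: le_trans.
    by rewrite lee_fin /= addr0 normr_ge0.
  apply: (@le_trans _ _ (tv_measure mu `]0, T]%classic)); last by rewrite leeDr// lee_fin.
  rewrite -(fineK fT) lee_fin; apply: total_sum_le => // [|l cl]; first exact: rect_incr.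
  by rewrite -lee_fin (fineK fT) chain_sum_le_tv_measure.
exists lam; split=> //.
- move=> A mA; apply/eqP; rewrite eq_le tvlam//=.
  have mCA : measurable (~` A) by exact: measurableC.
  have h := le_trans tvT (tv_measure_setID_le vmu setT mA).
  rewrite setTI setTD in h.
  have : (lam A + lam (~` A) <= tv_measure mu A + lam (~` A))%E.
    rewrite -measureU ?setUCr ?setICr//.
    by apply: le_trans h _; rewrite leeD// tvlam.
  by rewrite leeD2rE// lamf.
- by move=> c d cd; rewrite lamE// FB.
- by rewrite lamT ltry.
Unshelve. all: by end_near.
Qed.

End differential_measure.

(** * Integration against a vector measure *)

Section integral_of_set_functions.
Local Open Scope ereal_scope.
Context d (X : measurableType d) {R : realType}.
Import HBNNSimple.

(** The integral only evaluates its measure at measurable sets, hence it may be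
    computed with any measure that agrees there with a given set function. *)
Lemma eq_integral_measurable (m1 m2 : set X -> \bar R) (D : set X) (f : X -> \bar R) :
  (forall A, measurable A -> m1 A = m2 A) ->
  \int[m1]_(x in D) f x = \int[m2]_(x in D) f x.
Proof.
move=> m12; have eqs (h : {nnsfun X >-> R}) : sintegral m1 h = sintegral m2 h.
  by apply: eq_fsbigr => r _; rewrite m12.
by rewrite /integral; congr (ereal_sup _ - ereal_sup _);
  apply: eq_imagel => h _; exact: eqs.
Qed.

End integral_of_set_functions.

Section step_maps.
Context {R : realType} {H : normedModType R}.
Variable dot : {dot H for idfun}.
Hypothesis dotE : forall x : H, `|x| ^+ 2 = dot x x.
Variables (mu : set (measurableTypeR R) -> H).
Hypothesis vmu : vector_measure mu.
Variable lam : {measure set (measurableTypeR R) -> \bar R}.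
Hypothesis lamT : (lam setT < +oo)%E.
Hypothesis mulam : forall A, measurable A -> (`|mu A|%:E <= lam A)%E.
Implicit Types (A B : set (measurableTypeR R)) (c : H) (s : @step_data R H).

Lemma step_map_cons A c s t :
  step_map ((A, c) :: s) t = (\1_A t : R) *: c + step_map s t.
Proof. by rewrite /step_map big_cons. Qed.

Lemma step_map_nil t : step_map [::] t = 0 :> H.
Proof. by rewrite /step_map big_nil. Qed.

Lemma bounded_borel0 T : bounded_borel T (fun=> 0 : H).
Proof.
split; first by exists 0 => t _; rewrite normr0.
move=> U _; rewrite preimage_cst; by case: ifPn => _; rewrite ?setIT ?setI0.
Qed.

(** The sets of s are split off one at a time, because a sum of H-valued Borel
    functions need not be Borel if H is not separable. *)
Lemma measurable_norm_step T (g : R -> H) s B c : bounded_borel T g ->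
  {in s, forall p, measurable p.1} -> measurable B -> B `<=` `[0, T]%classic ->
  measurable_fun B (fun t : measurableTypeR R => `|c + step_map s t - g t|).
Proof.
move=> [_ bg]; elim: s B c => [|[A e] s IH] B c ms mB BT.
  move=> _; apply: (measurability _ (measurable_realfun.RGenOpens.measurableE R)).
  move=> _ [_ [a [b ->] <-]].
  pose V := (fun h : H => `|c - h|) @^-1` `]a, b[%classic.
  rewrite (_ : _ @^-1` _ = g @^-1` V); last first.
    by apply/funext => t; rewrite /V /preimage /= step_map_nil addr0.
  rewrite -(setIidl BT) -setIA; apply: measurableI; [exact: mB|apply: bg].
  apply: open_comp; last exact: interval_open.
  by move=> h _; apply: cvg_norm; apply: cvgB; [exact: cvg_cst|exact: cvg_id].
  exact: mB.
have mA : measurable A by apply: (ms (A, e)); rewrite inE eqxx.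
have ms' : {in s, forall p, measurable p.1}.
  by move=> p ps; apply: ms; rewrite inE ps orbT.
rewrite -(setUIDK B A); apply/measurable_funU.
- exact: measurableI.
- exact: measurableD.
split.
- apply: eq_measurable_fun (IH (B `&` A) (c + e) ms' _ _).
  + move=> t; rewrite inE => -[_ At]; rewrite step_map_cons indicE mem_set// scale1r.
    by rewrite addrA.
  + exact: measurableI.
  + by move=> t [/BT].
- apply: eq_measurable_fun (IH (B `\` A) c ms' _ _).
  + move=> t; rewrite inE => -[_ At]; rewrite step_map_cons indicE memNset// scale0r.
    by rewrite add0r.
  + exact: measurableD.
  + by move=> t [/BT].
Qed.

(** Each set of s divides B into two parts; on one of them its vector is absorbed
    into the constant c. *)
Lemma step_integral_le T s B c :
  {in s, forall p, measurable p.1} -> measurable B -> B `<=` `[0, T]%classic ->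
  ((dot c (mu B) + \sum_(p <- s) dot p.2 (mu (p.1 `&` B)))%:E <=
   \int[lam]_(t in B) (`|c + step_map s t|)%:E)%E.
Proof.
have bb0 := bounded_borel0 T.
elim: s B c => [|[A e] s IH] B c ms mB BT.
  rewrite big_nil addr0.
  rewrite (_ : (fun t => _) = cst `|c|%:E); last first.
    by apply/funext => t; rewrite step_map_nil addr0.
  rewrite integral_cst//; apply: (@le_trans _ _ (`|c|%:E * `|mu B|%:E)%E).
    by rewrite -EFinM lee_fin; exact: dot_le.
  by apply: lee_wpmul2l; rewrite ?lee_fin// mulam.
have mA : measurable A by apply: (ms (A, e)); rewrite inE eqxx.
have ms' : {in s, forall p, measurable p.1}.
  by move=> p ps; apply: ms; rewrite inE ps orbT.
have mBA : measurable (B `&` A) by exact: measurableI.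
have mBD : measurable (B `\` A) by exact: measurableD.
have BAT : B `&` A `<=` `[0, T]%classic by move=> t [/BT].
have BDT : B `\` A `<=` `[0, T]%classic by move=> t [/BT].
rewrite -{3}(setUIDK B A) ge0_integral_setU//; last 2 first.
- rewrite setUIDK; apply/measurable_EFinP.
  by apply: eq_measurable_fun (measurable_norm_step c bb0 ms mB BT) => t _; rewrite subr0.
- by apply/disj_setPS => t [[_ At] [_]].
rewrite (eq_integral (fun t : measurableTypeR R => (`|c + e + step_map s t|)%:E)); last first.
  move=> t; rewrite inE => -[_ At]; rewrite step_map_cons indicE mem_set// scale1r.
  by rewrite addrA.
rewrite [X in (_ <= _ + X)%E](eq_integral (fun t : measurableTypeR R => (`|c + step_map s t|)%:E)); last first.
  move=> t; rewrite inE => -[_ At]; rewrite step_map_cons indicE memNset// scale0r.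
  by rewrite add0r.
apply: le_trans (leeD (IH _ _ ms' mBA BAT) (IH _ _ ms' mBD BDT)).
rewrite -EFinD lee_fin big_cons /= (vector_measure_setID vmu mB mA) dotDr dotDl.
have -> : \sum_(p <- s) dot p.2 (mu (p.1 `&` B)) =
    \sum_(p <- s) dot p.2 (mu (p.1 `&` (B `&` A))) + \sum_(p <- s) dot p.2 (mu (p.1 `&` (B `\` A))).
  rewrite -big_split/= big_seq [RHS]big_seq; apply: eq_bigr => p ps.
  have mpB : measurable (p.1 `&` B) by apply: measurableI => //; exact: ms'.
  by rewrite -dotDr (vector_measure_setID vmu mpB mA) -!setIA -setIDA.
by rewrite [A `&` B]setIC; lra.
Qed.

End step_maps.

Section integral_bounds.
Context {R : realType} {H : normedModType R}.
Variable dot : {dot H for idfun}.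
Hypothesis dotE : forall x : H, `|x| ^+ 2 = dot x x.
Variables (mu : set (measurableTypeR R) -> H).
Hypothesis vmu : vector_measure mu.
Variable lam : {measure set (measurableTypeR R) -> \bar R}.
Hypothesis lamT : (lam setT < +oo)%E.
Hypothesis mulam : forall A, measurable A -> (`|mu A|%:E <= lam A)%E.
Hypothesis tvlam : forall A, measurable A -> tv_measure mu A = lam A.
Variable T : R.
Hypothesis muT : forall A, measurable A -> mu A = mu (A `&` `[0, T]).
Implicit Types (A : set (measurableTypeR R)).

Let mT : measurable (`[0, T]%classic : set (measurableTypeR R)).
Proof. exact: measurable_itv. Qed.

Let lam_fin A : measurable A -> lam A \is a fin_num.
Proof.
move=> mA; rewrite ge0_fin_numE//; apply: le_lt_trans lamT.
by apply: le_measure; rewrite ?inE.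
Qed.

Let measurable_scale_indic A (k : R) : measurable A ->
  measurable_fun (`[0, T]%classic : set (measurableTypeR R))
    (fun t => (k%:E * (\1_A t)%:E)%E).
Proof.
move=> mA; apply/(measurable_EFinP _ (fun t => k * \1_A t)).
by apply: measurable_funM => //; exact: measurable_indic.
Qed.

(** Step maps that approximate g in L^1 are nearly as close in L^1 to the map equal
    to c on A and to 0 elsewhere as g is, and [step_integral_le] transfers this
    to the integrals. *)
Lemma integral_dot_ge A g c w I : is_integral_dot dot T mu g I ->
  measurable A -> A `<=` `[0, T]%classic -> 0 <= w ->
  (forall t, A t -> `|g t - c| <= w) -> (forall t, t \in `[0, T] -> ~ A t -> g t = 0) ->
  dot c (mu A) <= I + w * fine (lam A).
Proof.
move=> [bg [s [ms sg sI]]] mA AT w0 gA gA'.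
apply/ler_addgt0Pl => e e0; have e2 : 0 < e / 2 by rewrite divr_gt0.
have /fine_cvgP[near_fin /cvgrPdist_le/(_ _ e2) near_small] := sg.
have /cvgrPdist_le/(_ _ e2) near_I := sI.
near \oo => n.
have hfin : (\int[tv_measure mu]_(t in `[0%R, T]) (`|g t - step_map (s n) t|)%:E)%E \is a fin_num.
  by near: n.
have hsmall : `|0 - fine (\int[tv_measure mu]_(t in `[0%R, T]) (`|g t - step_map (s n) t|)%:E)%E| <= e / 2.
  by near: n.
have hI : `|I - step_integral dot mu (s n)| <= e / 2 by near: n.
rewrite (eq_integral_measurable _ _ tvlam) in hfin hsmall.
set E := (\int[lam]_(t in _) _)%E in hfin hsmall.
pose s' := (A, c) :: [seq (p.1, - p.2) | p <- s n].
have ms' : {in s', forall p, measurable p.1}.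
  move=> p; rewrite inE => /orP[/eqP ->//|/mapP[q qs ->]].
  exact: ms qs.
have s'E t : step_map s' t = (\1_A t : R) *: c - step_map (s n) t.
  rewrite step_map_cons /step_map big_map /= -sumrN; congr (_ + _).
  by apply: eq_bigr => p _; rewrite scalerN.
have := step_integral_le dotE vmu mulam 0 ms' mT (@subset_refl _ _).
rewrite dot0l add0r big_cons big_map /= -muT//.
have -> : \sum_(p <- s n) dot (- p.2) (mu (p.1 `&` `[0, T])) = - step_integral dot mu (s n).
  rewrite /step_integral -sumrN big_seq [RHS]big_seq; apply: eq_bigr => p ps.
  by rewrite dotNl -muT//; exact: ms ps.
move=> h1.
have mE : measurable_fun (`[0, T]%classic : set (measurableTypeR R))
    (fun t => `|g t - step_map (s n) t|).
  apply: eq_measurable_fun (measurable_norm_step 0 bg (ms n) mT (@subset_refl _ _)) => t _.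
  by rewrite add0r distrC.
have : (\int[lam]_(t in `[0%R, T]) (`|0 + step_map s' t|)%:E <=
    \int[lam]_(t in `[0%R, T]) (w%:E * (\1_A t)%:E + (`|g t - step_map (s n) t|)%:E))%E.
  apply: ge0_le_integral => //.
  - apply/measurable_EFinP.
    apply: eq_measurable_fun (measurable_norm_step 0 (bounded_borel0 T) ms' mT (@subset_refl _ _)) => t _.
    by rewrite subr0.
  - by apply: emeasurable_funD; [exact: measurable_scale_indic|exact/measurable_EFinP].
  - move=> t /= tT; rewrite -EFinM -EFinD lee_fin add0r s'E.
    have -> : (\1_A t : R) *: c - step_map (s n) t =
        ((\1_A t : R) *: c - g t) + (g t - step_map (s n) t) by rewrite addrA subrK.
    rewrite (le_trans (ler_normD _ _))// lerD2r indicE.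
    have [At|At] := pselect (A t).
      by rewrite mem_set// scale1r mulr1 distrC gA.
    by rewrite memNset// scale0r mulr0 gA'// subrr normr0.
rewrite ge0_integralD//; last 3 first.
- by move=> t _; rewrite mule_ge0// lee_fin.
- exact: measurable_scale_indic.
- exact/measurable_EFinP.
rewrite ge0_integralZl_EFin//; last first.
  by apply/measurable_EFinP; exact: measurable_indic.
rewrite integral_indic// (setIidl AT) -/E => h2.
have := le_trans h1 h2.
rewrite -(fineK (lam_fin mA)) -(fineK hfin) -EFinM -EFinD lee_fin.
move: hsmall hI; rewrite sub0r normrN !ler_norml => /andP[_ ?] /andP[? ?]; lra.
Unshelve. all: by end_near.
Qed.

Lemma integral_sqr_le A (g : R -> H) (m : R) : bounded_borel T g -> measurable A ->
  A `<=` `[0, T]%classic -> 0 <= m ->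
  (forall t, A t -> `|g t| <= m) -> (forall t, t \in `[0, T] -> ~ A t -> g t = 0) ->
  (\int[tv_measure mu]_(t in `[0%R, T]) (`|g t| ^+ 2)%:E <= (m ^+ 2 * fine (lam A))%:E)%E.
Proof.
move=> bg mA AT m0 gA gA'; rewrite (eq_integral_measurable _ _ tvlam).
have mg : measurable_fun (`[0, T]%classic : set (measurableTypeR R)) (fun t => `|g t|).
  have ms0 : {in ([::] : @step_data R H), forall p, measurable p.1} by [].
  apply: eq_measurable_fun (measurable_norm_step 0 bg ms0 mT (@subset_refl _ _)) => t _.
  by rewrite step_map_nil add0r sub0r normrN.
apply: (@le_trans _ _ (\int[lam]_(t in `[0%R, T]) ((m ^+ 2)%:E * (\1_A t)%:E))%E).
  apply: ge0_le_integral => //.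
  - by apply/measurable_EFinP; exact: measurable_funX.
  - exact: measurable_scale_indic.
  - move=> t /= tT; rewrite -EFinM lee_fin indicE; have [At|At] := pselect (A t).
      by rewrite mem_set// mulr1 lerXn2r ?nnegrE// gA.
    by rewrite memNset// mulr0 gA'// normr0 expr0n.
rewrite ge0_integralZl_EFin ?sqr_ge0//; last first.
  by apply/measurable_EFinP; exact: measurable_indic.
by rewrite integral_indic// (setIidl AT) (EFinM (m ^+ 2)) fineK ?lam_fin.
Qed.

End integral_bounds.

(** * The variation over strict subdivisions *)

Section variation_on_chains.
Context {R : realType} {H : normedModType R}.
Implicit Types (F : R -> R -> R) (f : R -> H) (p q T : R) (l : seq R).

(** Repeated points contribute nothing and may be dropped. *)
Lemma strict_chain F p q l : (forall p, F p p = 0) -> chain p q l ->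
  exists l', [/\ path <%R p l', last p l' = q & chain_sum F p l' = chain_sum F p l].
Proof.
move=> F0; elim: l p => [|a l IH] p; first by move=> [_ /= <-]; exists [::].
move=> /chain_cons[pa /IH [l' [h1 h2 h3]]].
have [pE|pa'] := eqVneq a p.
  by exists l'; rewrite /= -h3 pE F0 add0r -{1 2}pE.
exists (a :: l'); split => //=; last by rewrite h3.
by rewrite h1 andbT lt_def pa' pa.
Qed.

Lemma chain_sum_nth F p l :
  chain_sum F p l = \sum_(i < size l) F (nth 0 (p :: l) i) (nth 0 (p :: l) i.+1).
Proof.
elim: l p => [|a l IH] p; first by rewrite big_ord0.
by rewrite /= IH big_ord_recl.
Qed.

Lemma chain_sum_le_variation_on f T p q l : 0 < T -> 0 <= p -> q <= T -> chain p q l ->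
  ((chain_sum (incr f) p l)%:E <= variation_on f `[0%R, T])%E.
Proof.
move=> T0 p0 qT /(strict_chain (incr0 f))[l' [h1 h2 <-]].
have [l0|l0] := eqVneq l' [::].
  apply: (@le_trans _ _ (`|f T - f 0|)%:E); first by rewrite l0 lee_fin normr_ge0.
  apply: ereal_sup_ubound; exists 1%N, (fun i => if i is 0%N then 0 else T).
  split=> //; first by case.
    by move=> [|[|i]] //= _; rewrite in_itv/= lexx (ltW T0).
  by rewrite big_ord_recl big_ord0 addr0.
apply: ereal_sup_ubound; exists (size l'), (nth 0 (p :: l')); split.
- by case: l' l0 {h1 h2}.
- by move=> i il; move/(pathP 0) : h1; apply.
- have hq : chain p q l'.
    by split=> //; apply: sub_path h1 => a b /ltW.
  move=> i il; rewrite /= in_itv/=.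
  have {il}: nth 0 (p :: l') i \in p :: l' by rewrite mem_nth.
  move: (nth 0 _ i) => x; elim: l' p p0 {l0 h1 h2} hq => [|a l' IH] p p0.
    by move=> [_ /= pE]; rewrite inE => /eqP ->; rewrite p0 pE.
  move=> /[dup] /chain_le pq /chain_cons[pa cl]; rewrite inE => /orP[/eqP ->|].
    by rewrite p0 (le_trans pq).
  by apply: IH => //; exact: le_trans pa.
- by rewrite chain_sum_nth.
Qed.

Lemma variation_on_le f T c : 0 < T ->
  (forall l, chain 0 T l -> chain_sum (incr f) 0 l <= c) ->
  (variation_on f `[0%R, T] <= c%:E)%E.
Proof.
move=> T0 hc; apply: ge_ereal_sup => _ [m [t [m0 tlt tJ ->]]].
rewrite lee_fin.
pose l := [seq t i | i <- iota 1 m].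
have chain_t k j : (k + j <= m)%N -> chain (t k) (t (k + j)%N) [seq t i | i <- iota k.+1 j].
  elim: j k => [|j IH] k kj; first by rewrite addn0.
  rewrite /=; apply/chain_cons; split; first by rewrite ltW// tlt//; lia.
  by rewrite -addSnnS; apply: IH; lia.
have chain_sum_t k j : chain_sum (incr f) (t k) [seq t i | i <- iota k.+1 j] =
    \sum_(k <= i < k + j) incr f (t i) (t i.+1).
  elim: j k => [|j IH] k; first by rewrite addn0 big_geq.
  by rewrite /= IH big_ltn ?addSnnS//; lia.
have [t0 tm] : 0 <= t 0%N /\ t m <= T.
  have := tJ 0%N (leq0n _); have := tJ m (leqnn _).
  by rewrite /= !in_itv/= => /andP[_ ->] /andP[-> _].
have /= cl := chain_cat (chain_seq1 t0) (chain_cat (chain_t 0%N m (leqnn _)) (chain_seq1 tm)).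
apply: le_trans (hc _ cl).
rewrite /= chain_sum_cat chain_sum_t add0n/= addr0 (proj2 (chain_t 0%N m (leqnn _))) add0n.
rewrite big_mkord -[leLHS]add0r lerD ?normr_ge0// lerDl normr_ge0//.
Qed.

Lemma chain_sum_clamp f T p l : 
  chain_sum (incr (fun t => f (clamp T t))) p l = chain_sum (incr f) (clamp T p) (map (clamp T) l).
Proof. by elim: l p => //= a l IH p; rewrite IH. Qed.

Lemma chain_clamp T p q l : chain p q l ->
  chain (clamp T p) (clamp T q) (map (clamp T) l).
Proof.
elim: l p => [|a l IH] p; first by move=> [_ /= <-].
move=> /chain_cons[pa cl]; apply/chain_cons; split; [exact: le_clamp|exact: IH].
Qed.

Lemma chain_sum_clamp_id f T p l : 0 <= p -> chain p T l ->
  chain_sum (incr (fun t => f (clamp T t))) p l = chain_sum (incr f) p l.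
Proof.
move=> p0 /[dup] /chain_le pT; elim: l p p0 pT => // a l IH p p0 pT.
move=> /chain_cons[pa /[dup] cl /chain_le aT] /=; rewrite IH ?(le_trans p0)//.
by rewrite /incr !clamp_id// (le_trans p0).
Qed.

Lemma BV_on_locBV f T : 0 < T -> BV_on T f <-> locBV (fun t => f (clamp T t)).
Proof.
move=> T0; split=> [bf p q|bf].
  have T0' := ltW T0; have V0 : (0 <= variation_on f `[0%R, T])%E.
    by apply: (chain_sum_le_variation_on f T0 (lexx 0) T0' (chain_nil 0)).
  exists (fine (variation_on f `[0%R, T])) => l cl.
  rewrite chain_sum_clamp -lee_fin fineK ?ge0_fin_numE//.
  by apply: chain_sum_le_variation_on (chain_clamp T cl); rewrite ?clamp_ge0 ?clamp_leT.
have [c hc] := bf 0 T.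
rewrite /BV_on (le_lt_trans (variation_on_le (c := c) T0 _)) ?ltry// => l cl.
by rewrite -(chain_sum_clamp_id f (lexx 0) cl) hc.
Qed.

Lemma variation_on_tvar f T : 0 < T -> locBV (fun t => f (clamp T t)) ->
  variation_on f `[0%R, T] = (tvar (fun t => f (clamp T t)) 0 T)%:E.
Proof.
move=> T0 bf; have T0' := ltW T0; apply/eqP; rewrite eq_le; apply/andP; split.
  apply: variation_on_le => // l cl; rewrite -(chain_sum_clamp_id f (lexx 0) cl).
  exact: (chain_sum_le_total_sum (rect_incr bf)).
have V0 : (variation_on f `[0%R, T] \is a fin_num)%E.
  rewrite ge0_fin_numE; first exact/(BV_on_locBV f T0).
  by apply: (chain_sum_le_variation_on f T0 (lexx 0) T0' (chain_nil 0)).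
rewrite -(fineK V0) lee_fin; apply: total_sum_le => // [|l cl]; first exact: rect_incr.
rewrite (chain_sum_clamp_id f (lexx 0) cl) -lee_fin (fineK V0).
exact: chain_sum_le_variation_on.
Qed.

End variation_on_chains.

(** * From the variational inequality to the local inequality *)

Section continuous_on_segment.
Context {R : realType} {H : normedModType R}.
Implicit Types (f : R -> H) (T : R).

Lemma unif_cont_clamp f T : 0 <= T -> {within `[0, T], continuous f} ->
  unif_cont (fun t => f (clamp T t)).
Proof.
move=> T0 cf e e0.
have e2 : 0 < e / 2 by rewrite divr_gt0.
pose P d p := p \in `[0, T] ->
  forall q, q \in `[0, T] -> p <= q -> q < p + d -> `|f q - f p| <= e.
have cov : near_covering (`[0, T]%classic : set R).
  by apply/compact_near_coveringP; exact: segment_compact.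
have hP : \forall d \near 0^'+, `[0, T]%classic `<=` P d.
  apply: cov => x xT.
  have /subspace_continuousP/(_ x xT)/cvgrPdist_le/(_ _ e2) := cf.
  rewrite near_withinE => /nbhs_ballP[k /= k0 hk].
  have k2 : 0 < k / 2 by rewrite divr_gt0.
  exists (ball x (k / 2), [set d | 0 < d < k / 2]).
    split=> /=; first exact: nbhsx_ballx.
    near=> d; apply/andP; split; [near: d; exact: nbhs_right_gt|near: d; exact: nbhs_right_lt].
  move=> [p d] /= [xp /andP[d0 dk]] pT q qT pq qd.
  rewrite /ball/= ltr_norml in xp; case/andP: xp => xp1 xp2.
  have hp : `|f x - f p| <= e / 2.
    by apply: hk => //; rewrite /ball/= ltr_norml; apply/andP; split; lra.
  have hq : `|f x - f q| <= e / 2.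
    by apply: hk => //; rewrite /ball/= ltr_norml; apply/andP; split; lra.
  have -> : f q - f p = (f x - f p) - (f x - f q) by rewrite opprB [RHS]addrC addrA subrK.
  by rewrite (le_trans (ler_normB _ _))//; lra.
near (0 : R)^'+ => d.
have d0 : 0 < d by near: d; exact: nbhs_right_gt.
have hd : `[0, T]%classic `<=` P d by near: d.
exists d => // p q pq qd.
apply: (hd (clamp T p)); rewrite /= ?clamp_itv//; first exact: le_clamp.
by have := clamp_dist T pq; lra.
Unshelve. all: by end_near.
Qed.

Lemma le_sup_norm f T t : 0 < T -> locBV (fun t => f (clamp T t)) -> t \in `[0, T] ->
  `|f t| <= sup_norm T f.
Proof.
move=> T0 bf tT; apply: sup_upper_bound; last by exists t.
split; first by exists `|f t|, t.
exists (`|f 0| + tvar (fun t => f (clamp T t)) 0 T) => _ [s + <-].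
rewrite /= in_itv/= => /andP[s0 sT].
have := le_tvar bf s0; rewrite (clamp_id s0 sT) (clamp_id (lexx 0) (ltW T0)) => h.
have := tvar_additive bf s0 sT; have := tvar_ge0 bf sT.
have := ler_normD (f s - f 0) (f 0); rewrite subrK; lra.
Qed.

Lemma sup_norm_le f T c : 0 <= T -> (forall t, t \in `[0, T] -> `|f t| <= c) ->
  sup_norm T f <= c.
Proof.
move=> T0 fc; apply: ge_sup; last by move=> _ [t tT <-]; exact: fc.
by exists `|f 0|, 0 => //=; rewrite in_itv/= lexx.
Qed.

End continuous_on_segment.

Section play.
Context {R : realType} {H : normedModType R}.
Variable dot : {dot H for idfun}.
Hypothesis dotE : forall x : H, `|x| ^+ 2 = dot x x.
Variables (T r : R) (Z : set H).
Hypotheses (T_gt0 : 0 < T) (r_gt0 : 0 < r).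
Implicit Types u y : R -> H.

Let T_ge0 : 0 <= T. Proof. exact: ltW. Qed.

Definition extend u t : H := u (clamp T t).
Definition state u y t : H := extend u t - extend y t.

Lemma locBV_state u y : locBV (extend u) -> locBV (extend y) -> locBV (state u y).
Proof.
move=> bu by_; have := locBV_lin (-1) bu by_.
by under eq_fun do rewrite scaleN1r.
Qed.

Lemma unif_cont_state u y : unif_cont (extend u) -> unif_cont (extend y) -> unif_cont (state u y).
Proof.
move=> cu cy e e0; have e2 : 0 < e / 2 by rewrite divr_gt0.
have [d1 d10 h1] := cu _ e2; have [d2 d20 h2] := cy _ e2.
exists (Num.min d1 d2) => [|p q pq]; first by rewrite lt_min d10.
rewrite -ltrBlDl lt_min !ltrBlDl => /andP[q1 q2].
have -> : state u y q - state u y p = (extend u q - extend u p) - (extend y q - extend y p).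
  by rewrite /state !opprD !opprK addrACA.
rewrite (le_trans (ler_normB _ _))//.
by have := h1 _ _ pq q1; have := h2 _ _ pq q2; lra.
Qed.

(** The variation of the state and two jumps of height m, located at p and q, form
    an additive majorant of the increments. *)
Lemma BV_on_patch u y p q z : locBV (extend u) -> locBV (extend y) -> p <= q ->
  BV_on T (fun t => if (p < t) && (t <= q) then z else u t - y t).
Proof.
move=> bu by_ pq; apply/BV_on_locBV => //.
have bx := locBV_state bu by_; set x := state u y in bx.
pose m := `|z - x 0| + tvar x 0 T.
have zx t : `|z - x t| <= m.
  have xE : x t = x (clamp T t).
    by rewrite /x /state /extend (clamp_id (clamp_ge0 T t) (clamp_leT t T_ge0)).
  rewrite xE; have c0 := clamp_ge0 T t; have cT := clamp_leT t T_ge0.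
  have := le_tvar bx c0; have := tvar_additive bx c0 cT; have := tvar_ge0 bx cT.
  have := ler_normB (z - x 0) (x (clamp T t) - x 0).
  have -> : z - x 0 - (x (clamp T t) - x 0) = z - x (clamp T t).
    by move: (x (clamp T t)) (x 0) => a b; rewrite opprB addrA subrK.
  by rewrite /m; lra.
have m0 : 0 <= m by rewrite (le_trans _ (zx 0)).
pose J (s t : R) : R := if s < clamp T t then 1 else 0.
pose A a b := tvar x a b + m * (J p b - J p a) + m * (J q b - J q a).
apply: (@bounded_sums_additive _ _ A) => [a b c ab bc|a b ab].
  by rewrite /A (tvar_additive bx ab bc); ring.
have cab := le_clamp T ab; rewrite /incr /A /J.
rewrite -/(extend u b) -/(extend y b) -/(state u y b).
rewrite -/(extend u a) -/(extend y a) -/(state u y a) -/x.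
have xab := le_tvar bx ab; have tab := tvar_ge0 bx ab.
have zxa := zx a; have zxb := zx b.
move: cab; move: (clamp T a) (clamp T b) => a' b' cab.
have [pa|pa] := ltP p a'; have [qa|qa] := ltP q a'; have [pb|pb] := ltP p b';
  have [qb|qb] := ltP q b'; rewrite /= ?(leNgt a' q) ?(leNgt b' q) ?qa ?qb /=.
all: try by lra.
all: try by rewrite ?subrr ?normr0; lra.
all: try by rewrite distrC; lra.
Qed.

(** The test function is z on ]p, q], cut off to [0, T], and the state elsewhere, so
    that the integrand vanishes outside of this interval. *)
Lemma play_ineq_of_is_play u z0 y : CBV_on T u -> is_play dot T r Z u z0 y ->
  play_ineq dot r Z (state u y) (extend y).
Proof.
move=> [cu bu] [[cy by_] Zuy _ [mu dmu hmu]].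
have bU : locBV (extend u) by exact/BV_on_locBV.
have bY : locBV (extend y) by exact/BV_on_locBV.
have cY : unif_cont (extend y) by exact: unif_cont_clamp.
have [lam [tvlam lamE lamT mulam]] := tv_measure_stieltjes dotE T_gt0 dmu bY cY.
have [vmu muT _ _] := dmu.
move=> p q c w z pq Zz osc; set x := state u y in osc.
have w0 : 0 <= w by rewrite (le_trans _ (osc p (lexx p) pq)).
pose p' := clamp T p; pose q' := clamp T q.
have pq' : p' <= q' by exact: le_clamp.
pose A : set (measurableTypeR R) := `]p', q']%classic.
have mA : measurable A by exact: measurable_itv.
have AT : A `<=` `[0, T]%classic.
  move=> t; rewrite /A /= !in_itv/= => /andP[pt tq]; apply/andP; split.
    by rewrite ltW// (le_lt_trans (clamp_ge0 T p)).
  by rewrite (le_trans tq)// clamp_leT.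
have xE t : t \in `[0, T] -> x t = u t - y t.
  by rewrite in_itv/= => /andP[t0 tT]; rewrite /x /state /extend clamp_id.
have oscA t : A t -> `|x t - c| <= w.
  move=> At; have := AT _ At; rewrite /= in_itv/= => /andP[t0 tT].
  move: At; rewrite /A /= in_itv/= => /andP[pt tq]; apply: osc.
    rewrite leNgt; apply/negP => /ltW/(le_clamp T); rewrite (clamp_id t0 tT).
    by rewrite leNgt pt.
  have t0' : 0 < t by rewrite (le_lt_trans _ pt)// clamp_ge0.
  rewrite leNgt; apply/negP => qt; move: tq; rewrite /q' /clamp le_max le_min.
  by rewrite leNgt t0' leNgt qt.
pose zf t := if (p' < t) && (t <= q') then z else u t - y t.
have bz : BV_on T zf by exact: BV_on_patch.
have Zzf t : t \in `[0, T] -> Z (zf t).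
  by move=> tT; rewrite /zf; case: ifP => // _; exact: Zuy.
have [I isI hI] := hmu zf bz Zzf.
pose g t := zf t - u t + y t; rewrite -/g in isI hI.
have gA t : A t -> g t = z - x t.
  move=> At; have tT := AT _ At.
  rewrite /g /zf xE//; move: At; rewrite /A /= in_itv/= => ->.
  by rewrite opprB addrAC addrA.
have gA' t : t \in `[0, T] -> ~ A t -> g t = 0.
  move=> tT At; rewrite /g /zf ifF; first by rewrite addrAC subrK subrr.
  by apply/negbTE/negP => At'; apply: At; rewrite /A /= in_itv.
have muA : mu A = extend y q - extend y p.
  rewrite /A (differential_measure_itvoc T_gt0 dmu)//.
  by rewrite /extend /p' /q' !(clamp_id (clamp_ge0 _ _) (clamp_leT _ _)).
have lamA : lam A = (tvar (extend y) p q)%:E.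
  by rewrite /A lamE// tvar_clamp.
have V0 : 0 <= tvar (extend y) p q by exact: tvar_ge0.
have := integral_dot_ge dotE vmu lamT mulam tvlam muT isI mA AT w0 (c := z - c) _ gA'.
rewrite muA lamA /=.
have h1 t : A t -> `|g t - (z - c)| <= w.
  move=> At; rewrite gA//.
  have -> : z - x t - (z - c) = - (x t - c).
    move: (x t) => a; rewrite !opprB [c - z]addrC addrACA subrr add0r.
    by rewrite [RHS]addrC.
  by rewrite normrN oscA.
move=> /(_ h1) h2; apply: (le_trans h2).
rewrite mulrDl lerD2r.
have m0 : 0 <= `|z - c| + w by rewrite addr_ge0.
have h3 : (\int[tv_measure mu]_(t in `[0%R, T]) (`|g t| ^+ 2)%:E <=
    ((`|z - c| + w) ^+ 2 * fine (lam A))%:E)%E.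
  apply: integral_sqr_le => //; first by case: isI.
  move=> t At; have := h1 _ At => h.
  have -> : g t = (z - c) + (g t - (z - c)) by rewrite addrC subrK.
  by rewrite (le_trans (ler_normD _ _))// lerD2l.
have r2 : 0 <= (2 * r)^-1 by rewrite invr_ge0 mulr_ge0// ltW.
have := le_trans hI (lee_wpmul2l _ h3); rewrite lee_fin => /(_ r2).
by rewrite -EFinM lee_fin lamA /=; lra.
Qed.

End play.

(** * Continuity in the strict metric *)

Section play_estimates.
Context {R : realType} {H : normedModType R}.
Variable dot : {dot H for idfun}.
Hypothesis dotE : forall x : H, `|x| ^+ 2 = dot x x.
Variables (T r : R) (Z : set H).
Hypotheses (T_gt0 : 0 < T) (r_gt0 : 0 < r).
Implicit Types u y : R -> H.

Let T_ge0 : 0 <= T. Proof. exact: ltW. Qed.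

Record play_data u y : Prop := PlayData {
  play_locBV_u : locBV (extend T u);
  play_locBV_y : locBV (extend T y);
  play_locBV_x : locBV (state T u y);
  play_unif_y : unif_cont (extend T y);
  play_unif_x : unif_cont (state T u y);
  play_inZ : forall t, Z (state T u y t);
  play_ineqP : play_ineq dot r Z (state T u y) (extend T y) }.

Lemma play_dataP u z0 y : CBV_on T u -> is_play dot T r Z u z0 y -> play_data u y.
Proof.
move=> /[dup] [[cu bu]] hu /[dup] [[[cy by_] Zuy _ _]] hy.
have bU : locBV (extend T u) by exact/BV_on_locBV.
have bY : locBV (extend T y) by exact/BV_on_locBV.
have cY : unif_cont (extend T y) by exact: unif_cont_clamp.
split=> //.
- exact: locBV_state.
- by apply: unif_cont_state => //; exact: unif_cont_clamp.
- by move=> t; apply: Zuy; exact: clamp_itv.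
- exact: play_ineq_of_is_play hu hy.
Qed.

Lemma state_add u y : (fun t => state T u y t + 1 *: extend T y t) = extend T u.
Proof. by apply/funext => t; rewrite scale1r /state subrK. Qed.

Lemma state_sub u y :
  (fun t => state T u y t + (- 1) *: extend T y t) = (fun t => extend T u t - 2 *: extend T y t).
Proof.
by apply/funext => t; rewrite scaleN1r /state -addrA -opprD -mulr2n -scaler_nat.
Qed.

Lemma tvar_reflection_le u y p q : play_data u y -> p <= q ->
  tvar (fun t => extend T u t - 2 *: extend T y t) p q <= tvar (extend T u) p q.
Proof.
move=> [bu by_ bx cy cx Zx xy] pq; rewrite -state_sub -(state_add u y).
have := tvar_reflect_le dotE r_gt0 bx by_ cx Zx xy (k := -1) _ pq.
by rewrite opprK normrN1; apply.
Qed.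

Lemma tvar_reflection_ge u y p q : play_data u y -> p <= q ->
  tvar (extend T u) p q <= tvar (fun t => extend T u t - 2 *: extend T y t) p q.
Proof.
move=> [bu by_ bx cy cx Zx xy] pq; rewrite -state_sub -(state_add u y).
have := tvar_reflect_le dotE r_gt0 bx by_ cx Zx xy (k := 1) _ pq.
by rewrite normr1; apply.
Qed.

(** 2 y is the difference of u and u - 2 y, which have the same variation. *)
Lemma tvar_play_le u y p q : play_data u y -> p <= q ->
  tvar (extend T y) p q <= tvar (extend T u) p q.
Proof.
move=> pd pq; have [bu by_ bx _ _ _ _] := pd.
apply: (total_sum_least (rect_incr by_) pq (tvar_additive bu)) => a b _ ab _.
have bw : locBV (fun t => extend T u t - 2 *: extend T y t).
  by rewrite -state_sub; exact: locBV_lin.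
have := le_trans (le_tvar bw ab) (tvar_reflection_le pd ab).
have := le_tvar bu ab; rewrite /incr.
have -> : extend T u b - 2 *: extend T y b - (extend T u a - 2 *: extend T y a) =
   (extend T u b - extend T u a) - 2 *: (extend T y b - extend T y a).
  by rewrite scalerBr !opprD !opprK addrACA.
move: (extend T u b - extend T u a) (extend T y b - extend T y a) => U Y hU hW.
have : `|2 *: Y| <= `|U| + `|U - 2 *: Y|.
  by have := ler_normB U (U - 2 *: Y); rewrite subKr.
rewrite normrZ ger0_norm//; lra.
Qed.

(** The exponent in the Gronwall estimate is at most the sum of the variations of
    the inputs, and the other factor is of order d. *)
Lemma play_uniform_continuity u y e : play_data u y -> 0 < e ->
  exists2 d, 0 < d & forall u' y', play_data u' y' ->
    (forall t, `|extend T u t - extend T u' t| <= d) ->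
    `|y 0 - y' 0| <= 2 * d -> tvar (extend T u') 0 T <= tvar (extend T u) 0 T + 1 ->
    forall t, `|extend T y t - extend T y' t| <= e.
Proof.
move=> pd e0; set V := tvar (extend T u) 0 T.
pose E := expR (2 / r * (V + V + 1)).
have E0 : 0 < E by exact: expR_gt0.
have c0 : 0 < (8 + 2 * r) * E by rewrite mulr_gt0// addr_gt0// mulr_gt0.
pose d := Num.min 1 (e ^+ 2 / ((8 + 2 * r) * E)).
have d_gt0 : 0 < d by rewrite lt_min ltr01 divr_gt0// exprn_gt0.
have d1 : d <= 1 by rewrite ge_min lexx.
have de : d * ((8 + 2 * r) * E) <= e ^+ 2 by rewrite -ler_pdivlMr// ge_min lexx orbT.
exists d => // u' y' pd' ud yd Vd t.
have [bu by_ bx cy cx Zx xy] := pd; have [bu' by' bx' cy' cx' Zx' xy'] := pd'.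
have ud' s : `|(state T u y s + extend T y s) - (state T u' y' s + extend T y' s)| <= d.
  by rewrite /state !subrK.
have t0 := clamp_ge0 T t; have tT := clamp_leT t T_ge0.
have := play_gronwall dotE r_gt0 by_ by' cx cx' cy cy' Zx Zx' xy xy' d_gt0 ud' t0.
have cc s : extend T s (clamp T t) = extend T s t.
  by rewrite /extend (clamp_id t0 tT).
have c00 s : extend T s 0 = s 0 by rewrite /extend (clamp_id (lexx 0) T_ge0).
rewrite !cc !c00.
have mE : expR (2 / r * (tvar (extend T y) 0 (clamp T t) + tvar (extend T y') 0 (clamp T t))) <= E.
  rewrite ler_expR ler_pM2l ?divr_gt0//.
  have := tvar_play_le pd t0; have := tvar_play_le pd' t0.
  have := tvar_additive bu t0 tT; have := tvar_additive bu' t0 tT.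
  have := tvar_ge0 bu tT; have := tvar_ge0 bu' tT; rewrite -/V; lra.
set m := expR _ in mE *; set k := 2 * r * d + 4 * d ^+ 2.
have k0 : 0 <= k by rewrite /k addr_ge0 ?mulr_ge0 ?sqr_ge0// ltW.
have y0 : `|y 0 - y' 0| ^+ 2 <= 4 * d ^+ 2.
  have -> : 4 * d ^+ 2 = (2 * d) ^+ 2 by ring.
  by rewrite lerXn2r ?nnegrE// mulr_ge0// ltW.
have kd : 4 * d ^+ 2 + k <= d * (8 + 2 * r).
  have : d ^+ 2 <= d by rewrite expr2 ler_piMr// ltW.
  by rewrite /k; lra.
have h1 : (`|y 0 - y' 0| ^+ 2 + k) * m <= d * (8 + 2 * r) * E.
  apply: ler_pM => //; [by rewrite addr_ge0// sqr_ge0|exact: expR_ge0|lra].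
move=> h2; rewrite -(@ler_pXn2r _ 2%N) ?nnegrE// ?(ltW e0)//.
rewrite mulrA in de; lra.
Qed.

End play_estimates.

Theorem theorem3p3 (R : realType) (H : completeNormedModType R)
  (dot : {dot H for idfun}) (dotE : forall x : H, `|x| ^+ 2 = dot x x)
  (H_neq0 : exists x : H, x != 0)
  (T r : R) (T_gt0 : 0 < T) (r_gt0 : 0 < r)
  (Z : set H) (Z_prox : prox_regular r Z)
  (u : R -> H) (u_ : nat -> R -> H) (z0 : H) (z0_ : nat -> H)
  (y : R -> H) (y_ : nat -> R -> H) :
  CBV_on T u -> (forall n, CBV_on T (u_ n)) ->
  Z z0 -> (forall n, Z (z0_ n)) ->
  is_play dot T r Z u z0 y ->
  (forall n, is_play dot T r Z (u_ n) (z0_ n) (y_ n)) ->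
  strict_dist T u (u_ n) @[n --> \oo] --> (0 : R) ->
  `|z0 - z0_ n| @[n --> \oo] --> (0 : R) ->
  strict_dist T y (y_ n) @[n --> \oo] --> (0 : R).
Proof.
move=> hu hun _ _ hy hyn /cvgrPdist_le du /cvgrPdist_le dz.
have T_ge0 := ltW T_gt0.
have pd := play_dataP dotE T_gt0 r_gt0 hu hy.
have pdn n := play_dataP dotE T_gt0 r_gt0 (hun n) (hyn n).
apply/cvgrPdist_le => e e0; have e2 : 0 < e / 2 by rewrite divr_gt0.
have [bu by_ _ _ _ _ _] := pd.
have [d1 d10 hd1] := tvar_continuous dotE T_ge0 e2 bu by_
  (tvar_reflection_ge dotE r_gt0 pd T_ge0).
have e3 : 0 < Num.min (e / 2) d1 by rewrite lt_min e2.
have [d2 d20 hd2] := play_uniform_continuity dotE T_gt0 r_gt0 pd e3.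
pose d := Num.min (Num.min d1 d2) 1.
have d_gt0 : 0 < d by rewrite !lt_min d10 d20 ltr01.
near=> n.
have un : `|0 - strict_dist T u (u_ n)| <= d by near: n; exact: du.
have zn : `|0 - `|z0 - z0_ n| | <= d by near: n; exact: dz.
have [bun byn _ _ _ _ _] := pdn n.
have dd1 : d <= d1 by rewrite !ge_min lexx.
have dd2 : d <= d2 by rewrite !ge_min lexx orbT.
have d_le1 : d <= 1 by rewrite !ge_min lexx orbT.
have varE (f : R -> H) : locBV (extend T f) -> fine (variation_on f `[0, T]) = tvar (extend T f) 0 T.
  by move=> bf; rewrite variation_on_tvar.
have subE (f g : R -> H) t : (f \- g) (clamp T t) = extend T f t - extend T g t by [].
have bsub (f g : R -> H) : locBV (extend T f) -> locBV (extend T g) -> locBV (extend T (f \- g)).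
  exact: locBV_state.
move: un; rewrite sub0r normrN /strict_dist (varE _ bu) (varE _ bun).
set s := sup_norm _ _; set v := `|tvar _ _ _ - _| => un.
have v0 : 0 <= v by exact: normr_ge0.
have ud t : `|extend T u t - extend T (u_ n) t| <= s.
  rewrite -subE; apply: le_sup_norm => //; [exact: bsub|exact: clamp_itv].
have s0 : 0 <= s by exact: le_trans (ud 0).
rewrite ger0_norm ?addr_ge0// in un.
have vd : tvar (extend T (u_ n)) 0 T <= tvar (extend T u) 0 T + d.
  by have : v <= d by [lra]; rewrite /v ler_norml => /andP[]; lra.
have y0d : `|y 0 - y_ n 0| <= 2 * d2.
  have [_ _ yz _] := hy; have [_ _ ynz _] := hyn n.
  have -> : y 0 - y_ n 0 = (u 0 - u_ n 0) - (z0 - z0_ n).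
    rewrite -yz -ynz; move: (u 0) (u_ n 0) (y 0) (y_ n 0) => a b c c'.
    by rewrite opprB addrA addrA subrK opprB [RHS]addrC addrA subrK.
  have := ud 0; rewrite /extend (clamp_id (lexx 0) T_ge0) => u0.
  move: zn; rewrite sub0r normrN normr_id => zn.
  rewrite (le_trans (ler_normB _ _))//; lra.
have yd t : `|extend T y t - extend T (y_ n) t| <= Num.min (e / 2) d1.
  apply: hd2 (pdn n) _ y0d _ t; last lra.
  by move=> t; apply: le_trans (ud t) _; lra.
rewrite sub0r normrN (varE _ by_) (varE _ byn) ger0_norm ?addr_ge0//; last first.
  have : 0 \in `[0, T] by rewrite in_itv/= lexx.
  move=> /(le_sup_norm T_gt0 (bsub _ _ by_ byn)); exact: le_trans.
have h1 : sup_norm T (y \- y_ n) <= e / 2.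
  apply: sup_norm_le => // t; rewrite in_itv/= => /andP[t0 tT].
  have := yd t; rewrite -subE (clamp_id t0 tT) => /le_trans; apply.
  by rewrite ge_min lexx.
have h2 : `|tvar (extend T y) 0 T - tvar (extend T (y_ n)) 0 T| <= e / 2.
  apply: hd1 bun byn _ _ _ _.
  - by move=> a b ab; exact: tvar_reflection_le (pdn n) ab.
  - by move=> t; apply: le_trans (ud t) _; lra.
  - by move=> t; apply: le_trans (yd t) _; rewrite ge_min lexx orbT.
  - by lra.
lra.
Unshelve. all: by end_near.
Qed.
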